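(* Let $\mathcal H$ be a separable Hilbert space, let $\mathfrak i$ be a stable Calkin space and let $\mathrm s$ be an $s$-function. Let $\Phi$ be an elementary operator on $\mathbf B(\mathcal H)$ (respectively, on $\mathbf K(\mathcal H)$). Then $\mathrm s(\Phi)\in\mathfrak i$ if and only if there exist $m\in\mathbb N$ and $A_i,B_i\in\mathbf B(\mathcal H)$, $i=1,\dots,m$, such that $\Phi=\sum_{i=1}^m M_{A_i,B_i}$ and $s(A_i),s(B_i)\in\mathfrak i$ for $i=1,\dots,m$.
   Context: $M_{A,B}$ denotes the operator $X\mapsto AXB$ (on $\mathbf B(\mathcal H)$, resp. on $\mathbf K(\mathcal H)$); an elementary operator is a finite sum $\sum_i M_{A_i,B_i}$. For a compact operator $T$, $s(T)$ is its non-increasing sequence of singular numbers; the condition $s(T)\in\mathfrak i$ is understood for compact $T$ (equivalently, $s(T)$ denotes the sequence of approximation numbers $\inf\{\|T-F\|:\mathrm{rank}F<n\}$, which coincides with the singular numbers for compact $T$ and lies in $c_0$ only if $T$ is compact). $c_0$: complex null sequences; for $\alpha\in c_0$, $\alpha^\star$ is the non-increasing rearrangement of $(|\alpha_n|)$. A Calkin space is a linear subspace $\mathfrak i\subseteq c_0$ with: $\alpha\in\mathfrak i$, $\beta\in c_0$, $\beta^\star\le\alpha^\star$ termwise $\Rightarrow\beta\in\mathfrak i$. For $\alpha,\beta\in c_0$, $\alpha\otimes\beta$ is the non-increasing rearrangement (with multiplicities) of $(|\alpha_i\beta_j|)_{i,j}$. $\mathfrak i\otimes\mathfrak i$ is the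 smallest Calkin space containing all $\alpha\otimes\beta$, $\alpha,\beta\in\mathfrak i$; $\mathfrak i$ is stable if $\mathfrak i\otimes\mathfrak i=\mathfrak i$. An $s$-function assigns to every bounded operator $T$ between Banach spaces a sequence $\mathrm s(T)$ of non-negative reals with: $\|T\|=\mathrm s_1(T)\ge\mathrm s_2(T)\ge\cdots$; $\mathrm s_n(S+T)\le\mathrm s_n(S)+\|T\|$; $\mathrm s_n(RST)\le\|R\|\|T\|\mathrm s_n(S)$; $\mathrm s_n(T)=0$ if $\mathrm{rank}T<n$; $\mathrm s_n(I_n)=1$ for the identity of $\ell_2^n$. *)

(* Defs.v *)
From HB Require Import structures.
From mathcomp Require Import all_boot all_order all_algebra.
From mathcomp Require Import boolp classical_sets functions reals.
From mathcomp Require Import complex.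

Set Implicit Arguments.
Unset Strict Implicit.
Unset Printing Implicit Defensive.
Import Order.TTheory GRing.Theory Num.Theory.
Local Open Scope classical_set_scope.
Local Open Scope ring_scope.

Definition cabs {R : realType} (z : R[i]) : R := Normc.normc z.

(* Normed spaces over C (as a subspace [nsdom] of an ambient C-vector  *)
(* space [nsV], with a norm [nsnorm]).                                 *)
Record nspace (R : realType) := NSpace {
  nsV : lmodType R[i];
  nsdom : set nsV;
  nsnorm : nsV -> R }.
Arguments NSpace {R}.
Arguments nsV {R} n : rename.
Arguments nsdom {R} n _ : rename.
Arguments nsnorm {R} n _ : rename.

Definition cauchy_in (R : realType) (X : nspace R) (u : nat -> nsV X) :=
  forall e : R, 0 < e -> exists N, forall m n, (N <= m)%N -> (N <= n)%N ->
    nsnorm X (u m - u n) < e.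

Definition converges_in (R : realType) (X : nspace R) (u : nat -> nsV X)
    (l : nsV X) :=
  forall e : R, 0 < e -> exists N, forall n, (N <= n)%N -> nsnorm X (u n - l) < e.

Definition is_banach (R : realType) (X : nspace R) : Prop :=
  [/\ nsdom X 0 /\
      (forall x y, nsdom X x -> nsdom X y -> nsdom X (x + y)),
      (forall (a : R[i]) x, nsdom X x -> nsdom X (a *: x)),
      (forall x, nsdom X x -> 0 <= nsnorm X x) /\
      (forall x, nsdom X x -> nsnorm X x = 0 -> x = 0),
      (forall (a : R[i]) x, nsdom X x -> nsnorm X (a *: x) = cabs a * nsnorm X x) /\
      (forall x y, nsdom X x -> nsdom X y ->
          nsnorm X (x + y) <= nsnorm X x + nsnorm X y) &
      (forall u : nat -> nsV X, (forall n, nsdom X (u n)) -> cauchy_in u ->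
          exists2 l, nsdom X l & converges_in u l)].

Definition bounded_op (R : realType) (X Y : nspace R) (f : nsV X -> nsV Y) :=
  [/\ (forall x, nsdom X x -> nsdom Y (f x)),
      (forall x y, nsdom X x -> nsdom X y -> f (x + y) = f x + f y),
      (forall (a : R[i]) x, nsdom X x -> f (a *: x) = a *: f x) &
      exists M : R, forall x, nsdom X x -> nsnorm Y (f x) <= M * nsnorm X x].

Definition opnorm (R : realType) (X Y : nspace R) (f : nsV X -> nsV Y) : R :=
  sup [set nsnorm Y (f x) | x in [set x | nsdom X x /\ nsnorm X x <= 1]].

Definition rank_lt (R : realType) (X Y : nspace R) (f : nsV X -> nsV Y) (n : nat) :=
  exists s : seq (nsV Y), (size s < n)%N /\
    forall x, nsdom X x -> exists c : nat -> R[i],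
      f x = \sum_(i < size s) c i *: nth 0 s i.

Definition l2n (R : realType) (n : nat) : nspace R :=
  NSpace ('rV[R[i]]_n : lmodType R[i]) setT
    (fun x => Num.sqrt (\sum_(i < n) cabs (x 0 i) ^+ 2)).

(* s-functions.  [s X Y T k] stands for s_{k+1}(T) (0-based index).   *)
(* s is defined on all operators between (normed data) X Y; the axioms *)
(* are required for bounded operators between Banach spaces; s only   *)
(* depends on the operator (its action on the domain).                 *)
Definition is_sfunction (R : realType)
    (s : forall X Y : nspace R, (nsV X -> nsV Y) -> nat -> R) : Prop :=
  [/\
      (forall (X Y : nspace R) (f g : nsV X -> nsV Y) k,
         (forall x, nsdom X x -> f x = g x) -> s X Y f k = s X Y g k) /\
      (forall (X Y : nspace R) (T : nsV X -> nsV Y),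
         is_banach X -> is_banach Y -> bounded_op T ->
         [/\ s X Y T 0%N = opnorm T,
             forall k, 0 <= s X Y T k &
             forall k, s X Y T k.+1 <= s X Y T k]),
      (forall (X Y : nspace R) (S T U : nsV X -> nsV Y),
         is_banach X -> is_banach Y -> bounded_op S -> bounded_op T ->
         (forall x, nsdom X x -> U x = S x + T x) ->
         forall k, s X Y U k <= s X Y S k + opnorm T),
      (forall (W X Y Z : nspace R) (T : nsV W -> nsV X) (S : nsV X -> nsV Y)
              (Rr : nsV Y -> nsV Z) (U : nsV W -> nsV Z),
         is_banach W -> is_banach X -> is_banach Y -> is_banach Z ->
         bounded_op T -> bounded_op S -> bounded_op Rr ->
         (forall x, nsdom W x -> U x = Rr (S (T x))) ->
         forall k, s W Z U k <= opnorm Rr * opnorm T * s X Y S k),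
      (forall (X Y : nspace R) (T : nsV X -> nsV Y),
         is_banach X -> is_banach Y -> bounded_op T ->
         forall k, rank_lt T k.+1 -> s X Y T k = 0) &
      (forall n : nat, s (l2n R n.+1) (l2n R n.+1) id n = 1)].

Definition hnorm (R : realType) (H : lmodType R[i]) (ip : H -> H -> R[i]) (x : H) : R :=
  Num.sqrt (complex.Re (ip x x)).

Definition hspace (R : realType) (H : lmodType R[i]) (ip : H -> H -> R[i]) : nspace R :=
  NSpace H setT (hnorm ip).

Definition is_hilbert (R : realType) (H : lmodType R[i]) (ip : H -> H -> R[i]) : Prop :=
  [/\ (forall (a : R[i]) x y z, ip (a *: x + y) z = a * ip x z + ip y z),
      (forall x y, ip y x = conjc (ip x y)),
      (forall x, 0 <= ip x x),
      (forall x, ip x x = 0 -> x = 0) &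
      (forall u : nat -> H, @cauchy_in R (hspace ip) u ->
          exists l, @converges_in R (hspace ip) u l)].

Definition separable (R : realType) (H : lmodType R[i]) (ip : H -> H -> R[i]) : Prop :=
  exists d : nat -> H, forall (x : H) (e : R), 0 < e -> exists n, hnorm ip (x - d n) < e.

Definition is_bop (R : realType) (H : lmodType R[i]) (ip : H -> H -> R[i]) (A : H -> H) :=
  @bounded_op R (hspace ip) (hspace ip) A.

Definition is_compact_op (R : realType) (H : lmodType R[i]) (ip : H -> H -> R[i])
    (A : H -> H) :=
  is_bop ip A /\
  forall u : nat -> H, (exists M : R, forall n, hnorm ip (u n) <= M) ->
    exists phi : nat -> nat, (forall n, (phi n < phi n.+1)%N) /\
      exists l, @converges_in R (hspace ip) (fun n => A (u (phi n))) l.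

Definition BH (R : realType) (H : lmodType R[i]) (ip : H -> H -> R[i]) : nspace R :=
  NSpace ((H -> H) : lmodType R[i]) (is_bop ip) (@opnorm R (hspace ip) (hspace ip)).

Definition KH (R : realType) (H : lmodType R[i]) (ip : H -> H -> R[i]) : nspace R :=
  NSpace ((H -> H) : lmodType R[i]) (is_compact_op ip) (@opnorm R (hspace ip) (hspace ip)).

(* singular numbers = approximation numbers, 0-based:
   sing A k = inf { ||A - F|| : F in B(H), rank F < k+1 } *)
Definition sing (R : realType) (H : lmodType R[i]) (ip : H -> H -> R[i]) (A : H -> H)
    (k : nat) : R :=
  inf [set @opnorm R (hspace ip) (hspace ip) (A - F) |
        F in [set F | is_bop ip F /\ @rank_lt R (hspace ip) (hspace ip) F k.+1]].

Definition Mop (R : realType) (H : lmodType R[i]) (A B : H -> H) : (H -> H) -> (H -> H) :=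
  fun X => A \o X \o B.

Definition c0 (R : realType) : set (nat -> R[i]) :=
  [set a | forall e : R, 0 < e -> exists N, forall n, (N <= n)%N -> cabs (a n) < e].

(* non-increasing rearrangement of (|a_n|) (0-based):
   rearr a n = inf_{|F| <= n} sup_{k notin F} |a_k| *)
Definition rearr (R : realType) (a : nat -> R[i]) (n : nat) : R :=
  inf [set sup [set cabs (a k) | k in [set k | k \notin F]] |
        F in [set F : seq nat | (size F <= n)%N]].

Definition is_calkin (R : realType) (I : set (nat -> R[i])) : Prop :=
  [/\ I 0,
      (forall a b, I a -> I b -> I (a + b)),
      (forall (c : R[i]) a, I a -> I (c *: a)),
      I `<=` @c0 R &
      (forall a b, I a -> @c0 R b -> (forall n, rearr b n <= rearr a n) -> I b)].

(* a (x) b : non-increasing rearrangement of (|a_i b_j|)_{i,j} *)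
Definition tens (R : realType) (a b : nat -> R[i]) : nat -> R[i] :=
  fun n => (inf [set sup [set cabs (a p.1 * b p.2) | p in [set p | p \notin F]] |
        F in [set F : seq (nat * nat) | (size F <= n)%N]])%:C%C.

Definition tens_sp (R : realType) (I : set (nat -> R[i])) : set (nat -> R[i]) :=
  [set x | forall J, is_calkin J -> (forall a b, I a -> I b -> J (tens a b)) -> J x].

Definition stable (R : realType) (I : set (nat -> R[i])) : Prop := tens_sp I = I.

Definition cseq (R : realType) (u : nat -> R) : nat -> R[i] := fun n => ((u n)%:C)%C.

Definition elem_rep (R : realType) (H : lmodType R[i]) (ip : H -> H -> R[i])
    (D : set (H -> H)) (Phi : (H -> H) -> (H -> H))
    (m : nat) (A B : 'I_m -> (H -> H)) : Prop :=
  (forall j, is_bop ip (A j) /\ is_bop ip (B j)) /\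
  (forall X, D X -> Phi X = \sum_(j < m) Mop (A j) (B j) X).

Definition elementary_on (R : realType) (H : lmodType R[i]) (ip : H -> H -> R[i])
    (D : set (H -> H)) (Phi : (H -> H) -> (H -> H)) : Prop :=
  exists m (A B : 'I_m -> (H -> H)), elem_rep ip D Phi A B.

(* Main.v *)
Require Import Defs.
From HB Require Import structures.
From mathcomp Require Import all_boot all_order all_algebra.
From mathcomp Require Import boolp classical_sets functions reals.
From mathcomp Require Import complex.
From mathcomp Require sequences normedtype topology.
From mathcomp Require Import ring lra.

(* Write a_k for the singular numbers, which are approximation numbers.

   Greedy vectors: for a bounded operator C choose unit vectors z_0, z_1, ...
   almost maximising |C z| subject to z _|_ z_j and z _|_ C* C z_j for the
   previous j.  The z_j are orthonormal with orthogonal images, and after n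
   steps C is bounded by a constant times a_n(C) on the orthogonal complement
   of a space of dimension 2n.

   If a_k(A) and a_k(B) are in the Calkin space, the greedy spaces of A* and B
   cut AXB into blocks of size about 2^-(p+q) |X|.  The blocks with p + q < N
   form an operator of rank at most the number of pairs with
   a_i(A) a_j(B) >~ 2^-N, and by a Schur test the remaining ones add up to
   O(2^-N) |X|.  So the approximation numbers of M_{A,B}, which dominate every
   s-function, are dominated by the tensor product of the singular number
   sequences, up to a dilation by 2.

   Conversely, take a representation of Phi of minimal length.  For fixed w, u
   the operator C = sum_i <B_i w, u> A_i is given by C v = Phi(v (x) u^* ) w,
   so the identity of l_2^n factors through Phi with norms controlled by
   1 / min_j |C z_j|; hence a_2n(C) = O(s_n(Phi)).  By minimality the B_i are
   linearly independent, so every A_i is a combination of such C.  The same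
   argument with the roles exchanged gives the B_i. *)

Set Implicit Arguments.
Unset Strict Implicit.
Unset Printing Implicit Defensive.
Import Order.TTheory GRing.Theory Num.Theory.
Local Open Scope classical_set_scope.
Local Open Scope ring_scope.
Local Notation Re := complex.Re.
Local Notation Im := complex.Im.

(** The greedy vectors replace the Schmidt expansion. For exact maximisers the images would be
    orthogonal by themselves, but a bounded operator need not attain its norm: each step maximises
    only up to a factor 2, and orthogonality of the images is imposed as a second constraint per
    step. The price is constants and an index n/2 in place of n, which a Calkin space absorbs
    because it contains a_(n/2) together with a_n.

    The obstacle in the upper bound is the number of blocks. About N of them have p + q = N, so
    adding their norms would only give N 2^-N |X|. The components of w and z in different blocks are
    orthogonal, and expanding <AXBw, z> along both decompositions lets an l_2 estimate remove the
    factor N; hence the choice of spaces for B and for the adjoint of A.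

    The lower bound tests Phi only on operators of rank one, and the approximants in the upper bound
    take values in finite sums of such operators. These lie in K(H) as well as in B(H), so both
    cases have one proof. *)

Section ComplexModulus.
Variable R : realType.
Implicit Types (z w : R[i]) (r : R).

Lemma cabs_ge0 z : 0 <= cabs z.
Proof. by case: z => a b; rewrite /cabs /= sqrtr_ge0. Qed.

Lemma cabsM z w : cabs (z * w) = cabs z * cabs w.
Proof. exact: Normc.normcM. Qed.

Lemma cabs0 : cabs (0 : R[i]) = 0.
Proof. exact: Normc.normc0. Qed.

Lemma cabs1 : cabs (1 : R[i]) = 1.
Proof. exact: Normc.normc1. Qed.

Lemma cabs_eq0 z : cabs z = 0 -> z = 0.
Proof. exact: Normc.eq0_normc. Qed.

Lemma ler_cabsD z w : cabs (z + w) <= cabs z + cabs w.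
Proof. exact: (@le_normcD R z w). Qed.

Lemma cabsN z : cabs (- z) = cabs z.
Proof. exact: (@normcN R z). Qed.

Lemma cabsJ z : cabs (conjc z) = cabs z.
Proof. by case: z => a b; rewrite /cabs /= sqrrN. Qed.

Lemma cabs_sqr z : cabs z ^+ 2 = Re z ^+ 2 + Im z ^+ 2.
Proof. by case: z => a b; rewrite /cabs /= sqr_sqrtr// addr_ge0 ?sqr_ge0. Qed.

Lemma mul_conjc z : z * conjc z = ((cabs z ^+ 2)%:C)%C.
Proof.
rewrite cabs_sqr; case: z => a b; apply/eqP; rewrite eq_complex /=.
by apply/andP; split; apply/eqP; ring.
Qed.

Lemma cabs_real r : cabs (r%:C)%C = `|r|.
Proof. by rewrite /cabs /= expr0n /= addr0 sqrtr_sqr. Qed.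

Lemma ler_Re_cabs z : `|Re z| <= cabs z.
Proof.
rewrite -(ler_pXn2r (n := 2)) ?nnegrE ?cabs_ge0//.
by rewrite cabs_sqr real_normK ?num_real// lerDl sqr_ge0.
Qed.

Lemma ler_Im_cabs z : `|Im z| <= cabs z.
Proof.
rewrite -(ler_pXn2r (n := 2)) ?nnegrE ?cabs_ge0//.
by rewrite cabs_sqr real_normK ?num_real// lerDr sqr_ge0.
Qed.

Lemma ler_cabs_ReIm z : cabs z <= `|Re z| + `|Im z|.
Proof.
rewrite -(ler_pXn2r (n := 2)) ?nnegrE ?cabs_ge0 ?addr_ge0//.
rewrite cabs_sqr sqrrD !real_normK ?num_real//.
have : 0 <= `|Re z| * `|Im z| by apply: mulr_ge0.
by move: (`|_| * `|_|) => t t0; rewrite -mulr_natl; lra.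
Qed.

Lemma ler_cabs_sum (J : Type) (t : seq J) (P : pred J) (f : J -> R[i]) :
  cabs (\sum_(i <- t | P i) f i) <= \sum_(i <- t | P i) cabs (f i).
Proof.
elim/big_rec2: _ => [|i y x _ le_xy]; first by rewrite cabs0.
by apply: (le_trans (ler_cabsD _ _)); rewrite lerD2l.
Qed.

Lemma ReD z w : Re (z + w) = Re z + Re w.
Proof. by case: z w => a b [c d]. Qed.

Lemma ReN z : Re (- z) = - Re z.
Proof. by case: z. Qed.

Lemma ReJ z : Re (conjc z) = Re z.
Proof. by case: z. Qed.

Lemma Re_mulr r z : Re ((r%:C)%C * z) = r * Re z.
Proof. by case: z => a b /=; rewrite mul0r subr0. Qed.

Lemma Re_sum (J : Type) (t : seq J) (P : pred J) (f : J -> R[i]) :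
  Re (\sum_(i <- t | P i) f i) = \sum_(i <- t | P i) Re (f i).
Proof. by apply: (big_morph _ ReD). Qed.

End ComplexModulus.

(** Completeness is left out, so that the lemmas on inner products are available for [rv_ip] while
    completeness of the row vectors is still being proved. *)
Definition is_inner (R : realType) (H : lmodType R[i]) (ip : H -> H -> R[i]) : Prop :=
  [/\ (forall (a : R[i]) x y z, ip (a *: x + y) z = a * ip x z + ip y z),
      (forall x y, ip y x = conjc (ip x y)),
      (forall x, 0 <= ip x x) &
      (forall x, ip x x = 0 -> x = 0)].

Lemma hilbert_inner (R : realType) (H : lmodType R[i]) (ip : H -> H -> R[i]) :
  is_hilbert ip -> is_inner ip.
Proof. by case. Qed.

(** * Inner products: Cauchy-Schwarz, Pythagoras, duality *)

Section InnerProduct.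
Variables (R : realType) (H : lmodType R[i]) (ip : H -> H -> R[i]).
Hypothesis ipP : is_inner ip.
Implicit Types (a : R[i]) (x y z : H).
Local Notation N := (hnorm ip).

Lemma ipC x y : ip y x = conjc (ip x y).
Proof. by case: ipP. Qed.

Lemma ipDl x y z : ip (x + y) z = ip x z + ip y z.
Proof. by case: ipP => lin _ _ _; rewrite -{1}[x]scale1r lin mul1r. Qed.

Lemma ip0l z : ip 0 z = 0.
Proof. by apply: (addrI (ip 0 z)); rewrite -ipDl !addr0. Qed.

Lemma ipZl a x z : ip (a *: x) z = a * ip x z.
Proof. by case: ipP => lin _ _ _; rewrite -{1}[a *: x]addr0 lin ip0l addr0. Qed.

Lemma ipNl x z : ip (- x) z = - ip x z.
Proof. by rewrite -scaleN1r ipZl mulN1r. Qed.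

Lemma ipBl x y z : ip (x - y) z = ip x z - ip y z.
Proof. by rewrite ipDl ipNl. Qed.

Lemma ipDr x y z : ip z (x + y) = ip z x + ip z y.
Proof. by rewrite ipC ipDl rmorphD /= -!ipC. Qed.

Lemma ip0r z : ip z 0 = 0.
Proof. by rewrite ipC ip0l conjc0. Qed.

Lemma ipZr a x z : ip z (a *: x) = conjc a * ip z x.
Proof. by rewrite ipC ipZl rmorphM /= -ipC. Qed.

Lemma ipNr x z : ip z (- x) = - ip z x.
Proof. by rewrite ipC ipNl rmorphN /= -ipC. Qed.

Lemma ipBr x y z : ip z (x - y) = ip z x - ip z y.
Proof. by rewrite ipDr ipNr. Qed.

Lemma ip_suml (J : Type) (t : seq J) (P : pred J) (f : J -> H) z :
  ip (\sum_(i <- t | P i) f i) z = \sum_(i <- t | P i) ip (f i) z.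
Proof. by elim/big_rec2: _ => [|i y x _ <-]; rewrite ?ip0l ?ipDl. Qed.

Lemma ip_sumr (J : Type) (t : seq J) (P : pred J) (f : J -> H) z :
  ip z (\sum_(i <- t | P i) f i) = \sum_(i <- t | P i) ip z (f i).
Proof. by elim/big_rec2: _ => [|i y x _ <-]; rewrite ?ip0r ?ipDr. Qed.

Lemma hnorm_ge0 x : 0 <= N x.
Proof. exact: sqrtr_ge0. Qed.

Lemma ipxx x : ip x x = ((N x ^+ 2)%:C)%C.
Proof.
case: ipP => _ _ /(_ x) + _; rewrite /hnorm; case: (ip x x) => a b.
rewrite lecE /= => /andP[/eqP -> a0].
by rewrite sqr_sqrtr.
Qed.

Lemma hnorm_sqr x : N x ^+ 2 = Re (ip x x).
Proof. by rewrite ipxx. Qed.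

Lemma hnorm0 : N 0 = 0.
Proof. by rewrite /hnorm ip0l sqrtr0. Qed.

Lemma hnorm_eq0 x : N x = 0 -> x = 0.
Proof. by move=> x0; case: ipP => _ _ _; apply; rewrite ipxx x0 expr0n. Qed.

Lemma hnorm_gt0 x : x != 0 -> 0 < N x.
Proof.
move=> x0; rewrite lt_neqAle hnorm_ge0 andbT eq_sym.
by apply: contra_neq x0 => /hnorm_eq0.
Qed.

Lemma hnormZ a x : N (a *: x) = cabs a * N x.
Proof.
apply/eqP; rewrite -(eqrXn2 (n := 2)) ?hnorm_ge0 ?mulr_ge0 ?cabs_ge0 ?hnorm_ge0//.
apply/eqP; rewrite hnorm_sqr ipZl ipZr mulrA mul_conjc ipxx -rmorphM /=.
by rewrite exprMn.
Qed.

Lemma hnormN x : N (- x) = N x.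
Proof. by rewrite -scaleN1r hnormZ cabsN cabs1 mul1r. Qed.

Lemma hnormB x y : N (x - y) = N (y - x).
Proof. by rewrite -hnormN opprB. Qed.

Lemma cauchy_schwarz x y : cabs (ip x y) <= N x * N y.
Proof.
have [->|y0] := eqVneq y 0; first by rewrite ip0r cabs0 hnorm0 mulr0.
rewrite -(ler_pXn2r (n := 2)) ?nnegrE ?mulr_ge0 ?cabs_ge0 ?hnorm_ge0// exprMn.
(* This square is |y|^2 (|x|^2 |y|^2 - |<x, y>|^2); scaling x by <y, y> avoids a division. *)
have := sqr_ge0 (N (ip y y *: x - ip x y *: y)).
have yy : 0 < N y ^+ 2 by rewrite exprn_gt0 ?hnorm_gt0.
rewrite hnorm_sqr ipBl !ipBr !ipZl !ipZr (ipC x y).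
rewrite !ipxx conjc_real.
move: (ip x y) (N x ^+ 2) (N y ^+ 2) yy => w X Y yy.
have -> : (Y%:C)%C * ((Y%:C)%C * (X%:C)%C) - (Y%:C)%C * (conjc w * w) -
   (w * ((Y%:C)%C * conjc w) - w * (conjc w * (Y%:C)%C)) =
  (Y%:C * (Y * X - cabs w ^+ 2)%:C)%C.
  rewrite rmorphB rmorphM /= -mul_conjc.
  by move: (conjc w) => cw; ring.
by rewrite Re_mulr pmulr_rge0// subr_ge0 mulrC.
Qed.

Lemma Re_ip_le x y : Re (ip x y) <= N x * N y.
Proof. exact: le_trans (ler_norm _) (le_trans (ler_Re_cabs _) (cauchy_schwarz _ _)). Qed.

Lemma hnorm_sqrD x y : N (x + y) ^+ 2 = N x ^+ 2 + N y ^+ 2 + 2 * Re (ip x y).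
Proof.
rewrite !hnorm_sqr ipDl !ipDr !ReD (ipC x y) ReJ; ring.
Qed.

Lemma ler_hnormD x y : N (x + y) <= N x + N y.
Proof.
rewrite -(ler_pXn2r (n := 2)) ?nnegrE ?addr_ge0 ?hnorm_ge0//.
by rewrite hnorm_sqrD sqrrD -mulr_natl; have := Re_ip_le x y; lra.
Qed.

Lemma ler_hnormB x y z : N (x - z) <= N (x - y) + N (y - z).
Proof. by apply: le_trans (ler_hnormD _ _); rewrite addrA subrK. Qed.

Lemma hnorm_sqrB x y : N (x - y) ^+ 2 = N x ^+ 2 + N y ^+ 2 - 2 * Re (ip x y).
Proof. by rewrite hnorm_sqrD hnormN ipNr ReN mulrN. Qed.

Lemma hnorm_sqrD_ortho x y : ip x y = 0 -> N (x + y) ^+ 2 = N x ^+ 2 + N y ^+ 2.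
Proof. by move=> xy; rewrite hnorm_sqrD xy mulr0 addr0. Qed.

Lemma ler_hnorm_sum (J : Type) (t : seq J) (P : pred J) (f : J -> H) :
  N (\sum_(i <- t | P i) f i) <= \sum_(i <- t | P i) N (f i).
Proof.
elim/big_rec2: _ => [|i y x _ le_xy]; first by rewrite hnorm0.
by apply: (le_trans (ler_hnormD _ _)); rewrite lerD2l.
Qed.

Lemma ip_inj x y : (forall z, ip x z = ip y z) -> x = y.
Proof.
move=> xy; apply/eqP; rewrite -subr_eq0; apply/eqP; case: ipP => _ _ _; apply.
by rewrite ipBl xy subrr.
Qed.

Lemma hnorm_le_dual x (M : R) : 0 <= M ->
  (forall z, cabs (ip x z) <= M * N z) -> N x <= M.
Proof.
move=> M0 /(_ x); rewrite ipxx cabs_real ger0_norm ?sqr_ge0// expr2.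
have [->|/hnorm_gt0 x0] := eqVneq x 0; first by rewrite hnorm0.
by rewrite ler_pM2r.
Qed.

End InnerProduct.

(** * Operator norms between Banach spaces *)

Section OperatorNorm.
Variables (R : realType) (X Y : nspace R).
Hypotheses (bX : is_banach X) (bY : is_banach Y).
Implicit Type f : nsV X -> nsV Y.

Lemma nsnorm0 : nsnorm X 0 = 0.
Proof.
case: bX => [[d0 _] _ _ [sc _] _].
by rewrite -(scale0r (0 : nsV X)) sc// cabs0 mul0r.
Qed.

Lemma bounded_op_cst f : bounded_op f ->
  exists2 M : R, 0 <= M & forall x, nsdom X x -> nsnorm Y (f x) <= M * nsnorm X x.
Proof.
case=> _ _ _ [M Mf]; exists `|M| => // x dx; apply: le_trans (Mf x dx) _.
by apply: ler_wpM2r; [case: bX => _ _ [+ _] _ _; apply|exact: ler_norm].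
Qed.

Lemma opnorm_ge0 f : bounded_op f -> 0 <= opnorm f.
Proof.
move=> bf; have [M M0 Mf] := bounded_op_cst bf.
case: bX => [[d0 _] _ _ _ _].
apply: (@le_trans _ _ (nsnorm Y (f 0))).
  by case: bY => _ _ [+ _] _ _; apply; case: bf => + _ _ _; apply.
apply: ub_le_sup; last by exists 0; rewrite //= nsnorm0.
exists M => _ [x [dx x1] <-]; apply: le_trans (Mf x dx) _.
by rewrite -[leRHS]mulr1 ler_wpM2l.
Qed.

Lemma opnormP f x : bounded_op f -> nsdom X x ->
  nsnorm Y (f x) <= opnorm f * nsnorm X x.
Proof.
move=> bf dx; have [M M0 Mf] := bounded_op_cst bf.
have nx0 : 0 <= nsnorm X x by case: bX => _ _ [+ _] _ _; apply.
have [x0|x0] := eqVneq (nsnorm X x) 0.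
  by rewrite x0 mulr0; apply: le_trans (Mf x dx) _; rewrite x0 mulr0.
have xp : 0 < nsnorm X x by rewrite lt_neqAle eq_sym x0.
rewrite -ler_pdivrMr//.
have dom : nsdom X (((nsnorm X x)^-1%:C)%C *: x) by case: bX => _ + _ _ _; apply.
have -> : nsnorm Y (f x) / nsnorm X x = nsnorm Y (f (((nsnorm X x)^-1%:C)%C *: x)).
  case: bf => fd _ fZ _; rewrite fZ//.
  have nYZ a y : nsdom Y y -> nsnorm Y (a *: y) = cabs a * nsnorm Y y.
    by case: bY => _ _ _ [+ _] _; apply.
  rewrite nYZ; last exact: fd.
  by rewrite cabs_real ger0_norm ?invr_ge0// mulrC.
apply: ub_le_sup; last first.
  exists (((nsnorm X x)^-1%:C)%C *: x) => //=; split => //.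
  have nXZ a y : nsdom X y -> nsnorm X (a *: y) = cabs a * nsnorm X y.
    by case: bX => _ _ _ [+ _] _; apply.
  by rewrite nXZ// cabs_real ger0_norm ?invr_ge0// mulVf.
exists M => _ [z [dz z1] <-]; apply: le_trans (Mf z dz) _.
by rewrite -[leRHS]mulr1 ler_wpM2l.
Qed.

Lemma opnorm_le f (M : R) : 0 <= M ->
  (forall x, nsdom X x -> nsnorm Y (f x) <= M * nsnorm X x) -> opnorm f <= M.
Proof.
move=> M0 Mf; apply: ge_sup.
  exists (nsnorm Y (f 0)); exists 0 => //=; split; last by rewrite nsnorm0.
  by case: bX => [[]].
move=> _ [x [dx x1] <-]; apply: le_trans (Mf x dx) _.
by rewrite -[leRHS]mulr1 ler_wpM2l.
Qed.

End OperatorNorm.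

Lemma quadratic_ge0_linear_eq0 (R : realType) (a g : R) : 0 <= a ->
  (forall t, 0 <= t ^+ 2 * a + 2 * t * g) -> g = 0.
Proof.
(* The minimum is at -g / a; the denominator a + 1 also serves a = 0, and the value is still
   negative unless g = 0. *)
move=> a0 /(_ (- g / (a + 1))).
have a1 : 0 < a + 1 by lra.
have -> : (- g / (a + 1)) ^+ 2 * a + 2 * (- g / (a + 1)) * g =
    - (g ^+ 2 * ((a + 2) / (a + 1) ^+ 2)) by field; rewrite gt_eqF.
rewrite oppr_ge0 pmulr_lle0; last by rewrite divr_gt0 ?exprn_gt0//; lra.
by move=> g0; apply/eqP; rewrite -sqrf_eq0 eq_le g0 sqr_ge0.
Qed.

Lemma invS_lt (R : realType) (e : R) : 0 < e ->
  exists N, forall n, (N <= n)%N -> n.+1%:R^-1 < e.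
Proof.
move=> e0; exists (Num.Def.archi_bound e^-1) => n le_n.
rewrite invf_plt ?posrE//; apply: lt_le_trans (archi_boundP _) _; first by rewrite invr_ge0 ltW.
by rewrite ler_nat (leq_trans le_n).
Qed.

(** * Hilbert spaces: Riesz representation, adjoints, the Banach space B(H) *)

Section HilbertSpace.
Variables (R : realType) (H : lmodType R[i]) (ip : H -> H -> R[i]).
Hypothesis hP : is_hilbert ip.
Local Notation N := (hnorm ip).
Local Notation hs := (hspace ip).
Local Notation opn := (@opnorm R hs hs).
Let ipP := hilbert_inner hP.

Lemma hspace_banach : is_banach hs.
Proof.
split=> //=.
- split=> [x _|x _]; first exact: hnorm_ge0.
  exact: hnorm_eq0.
- split=> [a x _|x y _ _]; first exact: hnormZ.
  exact: ler_hnormD.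
- by move=> u _ cu; case: hP => _ _ _ _ /(_ u cu)[l ul]; exists l.
Qed.

(** The representing vector minimises J(x) = |x|^2 - 2 Re f(x). The parallelogram law makes a
    minimising sequence Cauchy, and the vanishing first variation at its limit v gives Re f(x) = Re
    <x, v>. *)
Lemma riesz (f : H -> R[i]) (M : R) :
  (forall x y, f (x + y) = f x + f y) -> (forall a x, f (a *: x) = a * f x) ->
  (forall x, cabs (f x) <= M * N x) -> exists u, forall x, f x = ip x u.
Proof.
move=> fD fZ fM.
pose J x := N x ^+ 2 - 2 * Re (f x).
have Jlb x : - M ^+ 2 <= J x.
  have := le_trans (ler_norm _) (le_trans (ler_Re_cabs (f x)) (fM x)).
  by rewrite /J; have := sqr_ge0 (N x - M); rewrite sqrrB -mulr_natl; lra.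
pose d := inf (range J).
have dJ x : d <= J x.
  by apply: ge_inf; [exists (- M ^+ 2) => _ [y _ <-]|exists x].
have /choice[u uJ] : forall n : nat, exists x, J x < d + n.+1%:R^-1.
  move=> n; have : d < d + n.+1%:R^-1 by rewrite ltrDl invr_gt0.
  by case/(inf_lt (ex_intro _ _ (ex_intro2 _ _ 0 I erefl))) => _ [x _ <-]; exists x.
have par x y : N (x - y) ^+ 2 <= 2 * J x + 2 * J y - 4 * d.
  have := dJ (((2^-1)%:C)%C *: (x + y)).
  rewrite /J hnormZ// fZ Re_mulr fD cabs_real ger0_norm ?invr_ge0// exprMn ReD.
  by rewrite hnorm_sqrB// hnorm_sqrD//; lra.
have cu : @cauchy_in R hs u.
  move=> e e0; have [K Ke] := invS_lt (divr_gt0 (exprn_gt0 2 e0) (ltr0n R 4)).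
  exists K => m n Km Kn /=; rewrite -(ltr_pXn2r (n := 2)) ?nnegrE ?hnorm_ge0 ?ltW//.
  apply: le_lt_trans (par _ _) _.
  have := uJ m; have := uJ n; have := Ke _ Km; have := Ke _ Kn.
  by move: (J (u m)) (J (u n)) (m.+1%:R^-1) (n.+1%:R^-1) => *; lra.
case: hP => _ _ _ _ /(_ u cu)[v uv].
have ReP x : Re (f x) = Re (ip x v).
  apply/eqP; rewrite eq_sym -subr_eq0; apply/eqP.
  apply: (@quadratic_ge0_linear_eq0 _ (N x ^+ 2)); first exact: sqr_ge0.
  (* J is known to be close to its infimum only along [u n]. Half of e pays for J (u n) - d, the
     other half for replacing v by [u n] in the linear term. *)
  move=> t; rewrite -[leRHS]addr0; apply/ler_addgt0Pr => e e0.
  have T0 : 0 < 2 * `|t| * N x + 1.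
    by rewrite ltr_wpDl// !mulr_ge0// hnorm_ge0.
  have [K1 K1e] := invS_lt (divr_gt0 e0 (ltr0n R 2)).
  have [K2 K2e] := uv _ (divr_gt0 (divr_gt0 e0 (ltr0n R 2)) T0).
  have := K1e _ (leq_maxl K1 K2); have /= := K2e _ (leq_maxr K1 K2).
  move: (maxn K1 K2) => n; rewrite ltr_pdivlMr// => ne1 ne2.
  have := dJ (u n + ((t%:C)%C *: x)); have := uJ n.
  rewrite /J hnorm_sqrD// hnormZ// fD fZ ReD Re_mulr cabs_real exprMn.
  rewrite real_normK ?num_real// ipZr// conjc_real Re_mulr (ipC ipP x (u n)) ReJ.
  have : t * (Re (ip x (u n)) - Re (ip x v)) <= `|t| * N x * N (u n - v).
    rewrite -ReN -ReD -ipBr//; apply: le_trans (ler_norm _) _.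
    rewrite normrM -mulrA; apply: ler_wpM2l => //.
    by apply: le_trans (ler_Re_cabs _) _; apply: cauchy_schwarz.
  have : 0 <= N (u n - v) by exact: hnorm_ge0.
  move: ne1 ne2; move: (N (u n - v)) (N (u n)) (n.+1%:R^-1) (Re (ip x v)) (Re (ip x (u n))).
  move: (Re (f x)) (Re (f (u n))) (N x) (`|t|) (d) => *.
  nra.
exists v => x; apply/eqP; rewrite eq_complex ReP eqxx /=; apply/eqP.
(* The real part at i x is minus the imaginary part at x. *)
have := ReP (('i)%C *: x); rewrite fZ ipZl//.
by case: (f x) (ip x v) => a b [c e] /=; rewrite !mul0r !mul1r !sub0r => /oppr_inj.
Qed.

Lemma bopP A x : is_bop ip A -> N (A x) <= opn A * N x.
Proof. by move=> bA; apply: (opnormP hspace_banach hspace_banach bA). Qed.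

Lemma bop_opn_ge0 A : is_bop ip A -> 0 <= opn A.
Proof. exact: (opnorm_ge0 hspace_banach hspace_banach). Qed.

Lemma bop_opn_le A (M : R) : 0 <= M -> (forall x, N (A x) <= M * N x) -> opn A <= M.
Proof.
by move=> M0 AM; apply: (@opnorm_le _ hs hs) => // [|x _]; [exact: hspace_banach|exact: AM].
Qed.

Lemma bopD A (bA : is_bop ip A) x y : A (x + y) = A x + A y.
Proof. by case: bA => _ + _ _; apply. Qed.

Lemma bopZ A (bA : is_bop ip A) a x : A (a *: x) = a *: A x.
Proof. by case: bA => _ _ + _; apply. Qed.

Lemma bop0 A (bA : is_bop ip A) : A 0 = 0.
Proof. by rewrite -(scale0r (0 : H)) (bopZ bA) !scale0r. Qed.

Lemma bopN A (bA : is_bop ip A) x : A (- x) = - A x.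
Proof. by rewrite -scaleN1r (bopZ bA) scaleN1r. Qed.

Lemma bopB A (bA : is_bop ip A) x y : A (x - y) = A x - A y.
Proof. by rewrite (bopD bA) (bopN bA). Qed.

Lemma bop_sum A (bA : is_bop ip A) (J : Type) (t : seq J) (P : pred J) (f : J -> H) :
  A (\sum_(i <- t | P i) f i) = \sum_(i <- t | P i) A (f i).
Proof. by elim/big_rec2: _ => [|i y x _ <-]; rewrite ?(bop0 bA) ?(bopD bA). Qed.

Lemma is_bopP A (M : R) : (forall x y, A (x + y) = A x + A y) ->
  (forall a x, A (a *: x) = a *: A x) -> (forall x, N (A x) <= M * N x) ->
  is_bop ip A.
Proof.
move=> AD AZ AM; split=> [x _|x y _ _|a x _|]; [by []|exact: AD|exact: AZ|].
by exists M => x _; apply: AM.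
Qed.

Lemma is_bop0 : is_bop ip 0.
Proof.
have E x : (0 : H -> H) x = 0 by [].
by apply: (@is_bopP _ 0) => [x y|a x|x]; rewrite !E ?addr0 ?scaler0 ?hnorm0 ?mul0r.
Qed.

Lemma is_bopD A B : is_bop ip A -> is_bop ip B -> is_bop ip (A + B).
Proof.
move=> bA bB; apply: (@is_bopP _ (opn A + opn B)) => [x y|a x|x]; rewrite !fctE.
- by rewrite (bopD bA) (bopD bB) addrACA.
- by rewrite (bopZ bA) (bopZ bB) scalerDr.
- by rewrite mulrDl; apply: le_trans (ler_hnormD ipP _ _) (lerD (bopP _ bA) (bopP _ bB)).
Qed.

Lemma is_bopZ (a : R[i]) A : is_bop ip A -> is_bop ip (a *: A).
Proof.
move=> bA; apply: (@is_bopP _ (cabs a * opn A)) => [x y|c x|x]; rewrite /= !fctE.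
- by rewrite (bopD bA) scalerDr.
- by rewrite (bopZ bA) !scalerA mulrC.
- by rewrite hnormZ// -mulrA ler_wpM2l ?cabs_ge0// bopP.
Qed.

Lemma is_bopN A : is_bop ip A -> is_bop ip (- A).
Proof. by move=> bA; rewrite -scaleN1r; apply: is_bopZ. Qed.

Lemma is_bopB A B : is_bop ip A -> is_bop ip B -> is_bop ip (A - B).
Proof. by move=> bA bB; apply: is_bopD => //; apply: is_bopN. Qed.

Lemma is_bop_sum (J : Type) (t : seq J) (P : pred J) (f : J -> H -> H) :
  (forall i, is_bop ip (f i)) -> is_bop ip (\sum_(i <- t | P i) f i).
Proof. by move=> bf; elim/big_ind: _ => //; [exact: is_bop0|exact: is_bopD]. Qed.

Lemma is_bop_comp A B : is_bop ip A -> is_bop ip B -> is_bop ip (A \o B).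
Proof.
move=> bA bB; apply: (@is_bopP _ (opn A * opn B)) => [x y|a x|x] /=.
- by rewrite (bopD bB) (bopD bA).
- by rewrite (bopZ bB) (bopZ bA).
- by apply: le_trans (bopP _ bA) _; rewrite -mulrA ler_wpM2l ?bop_opn_ge0// bopP.
Qed.

Definition rank1 (y h : H) : H -> H := fun w => ip w h *: y.

Lemma rank1_le y h w : N (rank1 y h w) <= N y * N h * N w.
Proof.
rewrite hnormZ// mulrC -mulrA ler_wpM2l ?hnorm_ge0//.
by rewrite (mulrC (N h)); apply: cauchy_schwarz.
Qed.

Lemma is_bop_rank1 y h : is_bop ip (rank1 y h).
Proof.
apply: (@is_bopP _ (N y * N h)) => [u v|a u|u]; rewrite /rank1.
- by rewrite ipDl// scalerDl.
- by rewrite ipZl// scalerA.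
- exact: rank1_le.
Qed.

Lemma adjoint A : is_bop ip A -> exists2 B, is_bop ip B &
  forall x y, ip (A x) y = ip x (B y).
Proof.
move=> bA.
have /choice[B BP] : forall y, exists u, forall x, ip (A x) y = ip x u.
  move=> y; apply: (@riesz _ (opn A * N y)) => [u v|a u|x].
  - by rewrite (bopD bA) ipDl.
  - by rewrite (bopZ bA) ipZl.
  - apply: le_trans (cauchy_schwarz ipP _ _) _.
    by rewrite mulrAC ler_wpM2r ?hnorm_ge0// bopP.
exists B => //; apply: (@is_bopP _ (opn A)) => [x y|a x|x].
- by apply: (ip_inj ipP) => z; rewrite ipDl// !(ipC ipP z) -!BP ipDr// rmorphD.
- by apply: (ip_inj ipP) => z; rewrite ipZl// !(ipC ipP z) -!BP ipZr// rmorphM /= conjcK.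
- apply: (hnorm_le_dual ipP); first by rewrite mulr_ge0 ?bop_opn_ge0 ?hnorm_ge0.
  move=> z; rewrite (ipC ipP z) cabsJ -BP.
  apply: le_trans (cauchy_schwarz ipP _ _) _.
  by rewrite mulrAC ler_wpM2r ?hnorm_ge0// bopP.
Qed.

Lemma converges_unique (u : nat -> H) k l :
  @converges_in R hs u k -> @converges_in R hs u l -> k = l.
Proof.
move=> uk ul; apply/eqP; rewrite -subr_eq0; apply/eqP; apply: (hnorm_eq0 ipP).
apply/eqP; rewrite eq_le hnorm_ge0 andbT; apply/ler_addgt0Pr => e e0; rewrite add0r.
have [K Ke] := uk _ (divr_gt0 e0 (ltr0n R 2)).
have [L Le] := ul _ (divr_gt0 e0 (ltr0n R 2)).
have /= := Ke _ (leq_maxl K L); have /= := Le _ (leq_maxr K L).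
have := ler_hnormB ipP k (u (maxn K L)) l; rewrite (hnormB ipP k (u _)).
by move=> *; lra.
Qed.

Lemma convergesD (u v : nat -> H) k l :
  @converges_in R hs u k -> @converges_in R hs v l ->
  @converges_in R hs (fun n => u n + v n) (k + l).
Proof.
move=> uk vl e e0.
have [K Ke] := uk _ (divr_gt0 e0 (ltr0n R 2)).
have [L Le] := vl _ (divr_gt0 e0 (ltr0n R 2)).
exists (maxn K L) => n; rewrite geq_max => /andP[Kn Ln].
have /= := Ke _ Kn; have /= := Le _ Ln.
rewrite /= opprD addrACA; have := ler_hnormD ipP (u n - k) (v n - l).
by move=> *; lra.
Qed.

Lemma converges_bop A (u : nat -> H) k : is_bop ip A ->
  @converges_in R hs u k -> @converges_in R hs (A \o u) (A k).
Proof.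
move=> bA uk e e0.
have A1 : 0 < opn A + 1 by have := bop_opn_ge0 bA; lra.
have [K Ke] := uk _ (divr_gt0 e0 A1); exists K => n /Ke /=.
rewrite ltr_pdivlMr// -(bopB bA) => le_e; apply: le_lt_trans (bopP _ bA) _.
by have := hnorm_ge0 ip (u n - k); lra.
Qed.

Lemma converges_subseq (u : nat -> H) k (phi : nat -> nat) :
  (forall n, (phi n < phi n.+1)%N) ->
  @converges_in R hs u k -> @converges_in R hs (u \o phi) k.
Proof.
move=> ph uk e e0; have [K Ke] := uk e e0; exists K => n Kn; apply: Ke.
by apply: leq_trans Kn _; elim: n => // n IH; apply: leq_ltn_trans IH (ph n).
Qed.

Lemma is_bop_scaling (a : R[i]) : is_bop ip (fun x => a *: x).
Proof.
apply: (@is_bopP _ (cabs a)) => [x y|b x|x]; first exact: scalerDr.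
- by rewrite !scalerA mulrC.
- by rewrite hnormZ.
Qed.

(** Kept apart from completeness because K(H) carries the same norm on a smaller domain. *)
Lemma BH_banach_norm :
  [/\ (forall A, is_bop ip A -> 0 <= opn A),
      (forall A, is_bop ip A -> opn A = 0 -> A = 0),
      (forall (a : R[i]) A, is_bop ip A -> opn (a *: A) = cabs a * opn A) &
      (forall A B, is_bop ip A -> is_bop ip B -> opn (A + B) <= opn A + opn B)].
Proof.
have sc (a : R[i]) A : is_bop ip A -> opn (a *: A) <= cabs a * opn A.
  move=> bA; apply: bop_opn_le => [|x]; first by rewrite mulr_ge0 ?cabs_ge0 ?bop_opn_ge0.
  by rewrite hnormZ// -mulrA ler_wpM2l ?cabs_ge0 ?bopP.
split.
- exact: bop_opn_ge0.
- move=> A bA A0; apply/funext => x; apply: (hnorm_eq0 ipP); apply/eqP.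
  by rewrite eq_le hnorm_ge0 andbT; have := bopP x bA; rewrite A0 mul0r.
- move=> a A bA; apply/eqP; rewrite eq_le sc//=.
  have [->|a0] := eqVneq a 0; first by rewrite cabs0 mul0r bop_opn_ge0//; apply: is_bopZ.
  have ca : cabs a != 0 by apply: contra_neq a0 => /cabs_eq0.
  have /(@ler_wpM2l _ (cabs a) (cabs_ge0 a)) := sc a^-1 _ (is_bopZ a bA).
  rewrite scalerA mulVf// scale1r mulrA -cabsM mulfV// cabs1 mul1r.
  by [].
- move=> A B bA bB; apply: bop_opn_le => [|x]; first by rewrite addr_ge0 ?bop_opn_ge0.
  by rewrite mulrDl; apply: le_trans (ler_hnormD ipP _ _) (lerD (bopP _ bA) (bopP _ bB)).
Qed.

Lemma BH_complete (u : nat -> H -> H) : (forall n, is_bop ip (u n)) ->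
  @cauchy_in R (BH ip) u -> exists2 l, is_bop ip l & @converges_in R (BH ip) u l.
Proof.
move=> bu cu.
have /choice[l ul] : forall x, exists y, @converges_in R hs (u^~ x) y.
  move=> x; case: hP => _ _ _ _; apply => e e0.
  have x1 : 0 < N x + 1 by have := hnorm_ge0 ip x; lra.
  have [K Ke] := cu _ (divr_gt0 e0 x1); exists K => m n Km Kn /=.
  have /= := Ke m n Km Kn; rewrite ltr_pdivlMr// => le_e.
  have bmn := is_bopB (bu m) (bu n).
  apply: le_lt_trans (bopP x bmn) _.
  by have := bop_opn_ge0 bmn; lra.
(* Letting m tend to infinity in |u_n x - u_m x| <= e |x| keeps e, so the pointwise limit is also a
   limit in norm. *)
have key (e : R) K : (forall m n, (K <= m)%N -> (K <= n)%N -> opn (u m - u n) < e) ->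
    forall n, (K <= n)%N -> forall x, N (u n x - l x) <= e * N x.
  move=> Ke n Kn x; apply/ler_addgt0Pr => d d0.
  have [L Ld] := ul x _ d0.
  have /= := Ld _ (leq_maxr K L) => lt_d.
  have := bopP x (is_bopB (bu n) (bu (maxn K L))).
  have := ler_wpM2r (hnorm_ge0 ip x) (ltW (Ke _ _ Kn (leq_maxl K L))).
  rewrite !fctE; have := ler_hnormB ipP (u n x) (u (maxn K L) x) (l x).
  by move=> *; lra.
have bl : is_bop ip l.
  have [K K1] := cu _ ltr01.
  apply: (@is_bopP _ (1 + opn (u K))) => [x y|a x|x].
  - apply: (converges_unique (ul (x + y))).
    have -> : u^~ (x + y) = (fun n => u n x + u n y).
      by apply/funext => n; rewrite (bopD (bu n)).
    exact: convergesD.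
  - apply: (converges_unique (ul (a *: x))).
    have -> : u^~ (a *: x) = (fun y => a *: y) \o (u^~ x).
      by apply/funext => n /=; rewrite (bopZ (bu n)).
    exact/converges_bop/ul/is_bop_scaling.
  - have := key 1 K K1 K (leqnn K) x; have := bopP x (bu K).
    have := ler_hnormB ipP (l x) (u K x) 0.
    by rewrite !subr0 (hnormB ipP (l x) (u K x)); move=> *; lra.
exists l => // e e0; have [K Ke] := cu _ (divr_gt0 e0 (ltr0n R 2)).
exists K => n Kn; apply: (@le_lt_trans _ _ (e / 2)); last by lra.
by apply: bop_opn_le => [|x]; [lra|exact: key Kn x].
Qed.

Lemma BH_banach : is_banach (BH ip).
Proof.
have [n0 nz ns nt] := BH_banach_norm.
split=> //; first by split; [exact: is_bop0|exact: is_bopD].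
  exact: is_bopZ.
exact: BH_complete.
Qed.

End HilbertSpace.

(** * Subsequences and the diagonal argument *)

Section Subsequences.

Definition strictly_increasing (phi : nat -> nat) := forall n, (phi n < phi n.+1)%N.

Lemma strictly_increasing_ltn phi m n :
  strictly_increasing phi -> (m < n)%N -> (phi m < phi n)%N.
Proof.
move=> ph; elim: n => // n IH; rewrite ltnS leq_eqVlt => /orP[/eqP ->//|/IH].
by move=> /ltn_trans; apply.
Qed.

Lemma strictly_increasing_geq phi n : strictly_increasing phi -> (n <= phi n)%N.
Proof. by move=> ph; elim: n => // n IH; apply: leq_ltn_trans IH (ph n). Qed.

Lemma strictly_increasing_comp phi psi :
  strictly_increasing phi -> strictly_increasing psi ->
  strictly_increasing (phi \o psi).
Proof. by move=> ph ps n; apply: (strictly_increasing_ltn ph (ps n)). Qed.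

(** [D k i j] stands for a Cauchy condition of tolerance k between the indices i and j: each
    tolerance can be met along a further subsequence, and the diagonal meets all of them
    eventually. *)
Lemma diagonal_subsequence (D : nat -> nat -> nat -> Prop) :
  (forall k psi, strictly_increasing psi -> exists2 chi, strictly_increasing chi &
     forall m n, D k (psi (chi m)) (psi (chi n))) ->
  exists2 phi, strictly_increasing phi &
    forall k m n, (k <= m)%N -> (k <= n)%N -> D k (phi m) (phi n).
Proof.
move=> DP.
have /choice[ch chP] : forall kp : nat * (nat -> nat), exists chi,
    strictly_increasing kp.2 -> strictly_increasing chi /\
    forall m n, D kp.1 (kp.2 (chi m)) (kp.2 (chi n)).
  move=> [k psi]; have [ip|ip] := pselect (strictly_increasing psi).
    by have [chi ic cD] := DP k psi ip; exists chi.
  by exists id.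
pose psi := fix psi k := if k is j.+1 then psi j \o ch (j, psi j) else id.
have ipsi k : strictly_increasing (psi k).
  elim: k => [|k IH]; first by move=> n; exact: ltnSn.
  apply: (strictly_increasing_comp IH).
  by have [] := chP (k, psi k) IH.
have sub k m n : exists i, psi (k + m)%N n = psi k i.
  elim: m n => [|m IH] n; first by exists n; rewrite addn0.
  by rewrite addnS /=; apply: IH.
have Dk k m n : D k (psi k.+1 m) (psi k.+1 n).
  by have [_] := chP (k, psi k) (ipsi k); apply.
(* The index is k + 1 because [D k] is enforced in the passage from [psi k] to [psi k.+1]. *)
exists (fun k => psi k.+1 k).
  move=> k; have [ic _] := chP (k.+1, psi k.+1) (ipsi k.+1).
  exact: (strictly_increasing_ltn (ipsi k.+1) (strictly_increasing_geq k.+1 ic)).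
move=> k m n km kn.
have [j] := sub k.+1 (n - k)%N n; rewrite addSn subnKC// => ->.
by have [i ] := sub k.+1 (m - k)%N m; rewrite addSn subnKC// => ->.
Qed.

End Subsequences.

(** * Bolzano-Weierstrass and completeness for complex sequences *)

Section BolzanoWeierstrass.
Import sequences normedtype topology numFieldNormedType.Exports.
Variable R : realType.

Lemma real_bounded_subseq (u : nat -> R) (M : R) : (forall n, `|u n| <= M) ->
  exists2 phi, strictly_increasing phi &
  exists l, forall e, 0 < e -> exists K, forall n, (K <= n)%N -> `|u (phi n) - l| < e.
Proof.
move=> uM.
have [|f fi fc] := @bolzano_weierstrass R u.
  exists M; split; first exact: num_real.
  by move=> x Mx n _; apply: le_trans (uM n) (ltW Mx).
exists f => [n|]; first by rewrite ltnNge [(_ <= _)%N]fi -ltnNge.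
exists (lim ((u \o f) @ \oo)) => e e0; have /cvgrPdist_lt/(_ e e0)[K _ Ke] := fc.
by exists K => n /Ke; rewrite distrC.
Qed.

End BolzanoWeierstrass.

Section ComplexSequences.
Variable R : realType.

Lemma complex_bounded_subseq (u : nat -> R[i]) (M : R) : (forall n, cabs (u n) <= M) ->
  exists2 phi, strictly_increasing phi &
  exists l, forall e, 0 < e -> exists K, forall n, (K <= n)%N -> cabs (u (phi n) - l) < e.
Proof.
move=> uM.
have [p ip [a pa]] := real_bounded_subseq (fun n => le_trans (ler_Re_cabs (u n)) (uM n)).
have [q iq [b qb]] :=
  real_bounded_subseq (fun n => le_trans (ler_Im_cabs (u (p n))) (uM (p n))).
exists (p \o q); first exact: strictly_increasing_comp.
exists (a +i* b)%C => e e0.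
have [K Ke] := pa _ (divr_gt0 e0 (ltr0n R 2)).
have [L Le] := qb _ (divr_gt0 e0 (ltr0n R 2)).
exists (maxn K L) => n; rewrite geq_max => /andP[Kn Ln].
have Ke1 := Ke _ (leq_trans Kn (strictly_increasing_geq n iq)); have Le1 := Le _ Ln.
apply: le_lt_trans (ler_cabs_ReIm _) _.
by move: Le1 Ke1 => /=; case: (u _) => c d /=; lra.
Qed.

Lemma complex_cauchy_cvg (u : nat -> R[i]) :
  (forall e, 0 < e -> exists K, forall m n, (K <= m)%N -> (K <= n)%N ->
    cabs (u m - u n) < e) ->
  exists l, forall e, 0 < e -> exists K, forall n, (K <= n)%N -> cabs (u n - l) < e.
Proof.
move=> cu; have [K0 K01] := cu 1 ltr01.
pose v n := u (K0 + n)%N.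
have vM n : cabs (v n) <= cabs (u K0) + 1.
  have := K01 _ _ (leq_addr n K0) (leqnn K0).
  have := ler_cabsD (v n - u K0) (u K0); rewrite subrK /v.
  by move=> *; lra.
have [phi iphi [l vl]] := complex_bounded_subseq vM.
exists l => e e0.
have [K Ke] := cu _ (divr_gt0 e0 (ltr0n R 2)).
have [L Le] := vl _ (divr_gt0 e0 (ltr0n R 2)).
exists K => n Kn; have := Le _ (leq_maxr K L); rewrite /v.
have Kp : (K <= K0 + phi (maxn K L))%N.
  apply: leq_trans (leq_addl _ _).
  exact: leq_trans (leq_maxl K L) (strictly_increasing_geq _ iphi).
have := Ke _ _ Kn Kp.
have := ler_cabsD (u n - u (K0 + phi (maxn K L))%N) (u (K0 + phi (maxn K L))%N - l).
by rewrite addrA subrK; move=> *; lra.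
Qed.

End ComplexSequences.

(** * The finite-dimensional Hilbert spaces l_2^n *)

Section EuclideanSpace.
Variables (R : realType) (n : nat).

Definition rv_ip (x y : 'rV[R[i]]_n) : R[i] := \sum_(j < n) x 0 j * conjc (y 0 j).

Lemma l2n_norm x : nsnorm (l2n R n) x = hnorm rv_ip x.
Proof.
rewrite /= /hnorm; congr Num.sqrt; rewrite Re_sum; apply: eq_bigr => j _.
by rewrite mul_conjc.
Qed.

Lemma rv_ip_inner : is_inner rv_ip.
Proof.
have xx x : rv_ip x x = ((\sum_(j < n) cabs (x 0 j) ^+ 2)%:C)%C.
  by rewrite rmorph_sum; apply: eq_bigr => j _; rewrite mul_conjc.
split.
- move=> a x y z; rewrite /rv_ip mulr_sumr -big_split; apply: eq_bigr => j _ /=.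
  by rewrite !mxE mulrDl mulrA.
- move=> x y; rewrite /rv_ip rmorph_sum; apply: eq_bigr => j _ /=.
  by rewrite rmorphM /= conjcK mulrC.
- by move=> x; rewrite xx ler0c sumr_ge0// => j _; rewrite sqr_ge0.
- move=> x; rewrite xx => -[/eqP]; rewrite psumr_eq0; last by move=> *; exact: sqr_ge0.
  move=> /allP x0; apply/rowP => j; rewrite mxE; apply: cabs_eq0; apply/eqP.
  by rewrite -sqrf_eq0; have := x0 j (mem_index_enum j).
Qed.

Lemma cabs_coord_le (x : 'rV[R[i]]_n) j : cabs (x 0 j) <= hnorm rv_ip x.
Proof.
rewrite -(ler_pXn2r (n := 2)) ?nnegrE ?cabs_ge0 ?hnorm_ge0//.
rewrite -l2n_norm /= sqr_sqrtr; last by rewrite sumr_ge0// => k _; rewrite sqr_ge0.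
by rewrite (bigD1 j)//= lerDl sumr_ge0// => k _; rewrite sqr_ge0.
Qed.

Lemma l2n_banach : is_banach (l2n R n).
Proof.
have ipn := rv_ip_inner.
split=> //.
- split=> x _; rewrite l2n_norm; first exact: hnorm_ge0.
  exact: (hnorm_eq0 ipn).
- split=> [a x _|x y _ _]; rewrite !l2n_norm; first exact: hnormZ.
  exact: ler_hnormD.
move=> u _ cu.
have /choice[l ul] : forall j, exists c, forall e, 0 < e ->
    exists K, forall k, (K <= k)%N -> cabs (u k 0 j - c) < e.
  move=> j; apply: complex_cauchy_cvg => e e0.
  have [K Ke] := cu _ e0; exists K => p q Kp Kq.
  apply: le_lt_trans (Ke _ _ Kp Kq); rewrite l2n_norm.
  by have := cabs_coord_le (u p - u q) j; rewrite !mxE.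
exists (\row_j l j) => // e e0.
(* With n coordinate errors below e / (n + 1) the sum stays strictly below e, and n = 0 is
   included. *)
have n0 : 0 < (n.+1%:R : R) by [].
have /choice[K KP] : forall j, exists K, forall k, (K <= k)%N ->
    cabs (u k 0 j - l j) < e / n.+1%:R.
  by move=> j; apply: ul; rewrite divr_gt0.
exists (\max_j K j) => k Kk; rewrite l2n_norm.
have -> : u k - \row_j l j = \sum_j (u k 0 j - l j) *: delta_mx 0 j.
  by rewrite [LHS]row_sum_delta; apply: eq_bigr => j _; rewrite !mxE.
apply: le_lt_trans (ler_hnorm_sum ipn _ _ _) _.
apply: (@le_lt_trans _ _ (\sum_(j < n) e / n.+1%:R)).
  apply: ler_sum => j _; rewrite hnormZ//.
  have -> : hnorm rv_ip (delta_mx 0 j) = 1.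
    rewrite -l2n_norm /= (bigD1 j)//= big1 => [|i ij]; rewrite mxE eqxx/=.
      by rewrite eqxx cabs1 expr1n addr0 sqrtr1.
    by rewrite (negbTE ij) cabs0 expr0n.
  by rewrite mulr1 ltW// KP// (leq_trans (leq_bigmax j)).
rewrite sumr_const card_ord -(mulr_natr (e / _)) -mulrA gtr_pMr// ltr_pdivrMl// mulr1.
by rewrite ltr_nat.
Qed.

End EuclideanSpace.

(** * Compact operators and the Banach space K(H) *)

Section CompactOperators.
Variables (R : realType) (H : lmodType R[i]) (ip : H -> H -> R[i]).
Hypothesis hP : is_hilbert ip.
Local Notation N := (hnorm ip).
Local Notation hs := (hspace ip).
Local Notation opn := (@opnorm R hs hs).
Let ipP := hilbert_inner hP.

Lemma compactD A B : is_compact_op ip A -> is_compact_op ip B -> is_compact_op ip (A + B).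
Proof.
move=> [bA cA] [bB cB]; split=> [|u [M uM]]; first exact: is_bopD.
have [p [ip_ [k Ak]]] := cA u (ex_intro _ M uM).
have [q [iq [l Bl]]] := cB (u \o p) (ex_intro _ M (fun n => uM (p n))).
exists (p \o q); split; first exact: strictly_increasing_comp.
exists (k + l); apply: (@convergesD _ _ _ hP _ _ k l) => //.
exact: (converges_subseq iq Ak).
Qed.

Lemma compact_compl A B : is_bop ip A -> is_compact_op ip B -> is_compact_op ip (A \o B).
Proof.
move=> bA [bB cB]; split=> [|u uM]; first exact: is_bop_comp.
have [p [ip_ [k Bk]]] := cB u uM; exists p; split=> //.
by exists (A k); apply: (converges_bop hP bA Bk).
Qed.

Lemma compact_compr A B : is_compact_op ip A -> is_bop ip B -> is_compact_op ip (A \o B).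
Proof.
move=> [bA cA] bB; split=> [|u [M uM]]; first exact: is_bop_comp.
apply: (cA (B \o u)); exists (opn B * M) => n.
by apply: le_trans (bopP hP _ bB) _; rewrite ler_wpM2l// bop_opn_ge0.
Qed.

Lemma compactZ (a : R[i]) A : is_compact_op ip A -> is_compact_op ip (a *: A).
Proof. exact: (compact_compl (is_bop_scaling hP a)). Qed.

Lemma compact_rank1 y h : is_compact_op ip (rank1 ip y h).
Proof.
split=> [|u [M uM]]; first exact: is_bop_rank1.
have [|p ip_ [l pl]] := @complex_bounded_subseq _ (fun n => ip (u n) h) (M * N h).
  move=> n; apply: le_trans (cauchy_schwarz ipP _ _) _.
  by rewrite ler_wpM2r ?hnorm_ge0.
exists p; split=> //; exists (l *: y) => e e0.
have y1 : 0 < N y + 1 by have := hnorm_ge0 ip y; lra.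
have [K Ke] := pl _ (divr_gt0 e0 y1); exists K => n /Ke /=.
rewrite /rank1 -scalerBl hnormZ// ltr_pdivlMr//.
by have := cabs_ge0 (ip (u (p n)) h - l); lra.
Qed.

Lemma compact0 : is_compact_op ip 0.
Proof. by rewrite -(scale0r (rank1 ip 0 0)); apply/compactZ/compact_rank1. Qed.

(** The diagonal runs over tolerances: for each 1/(k+1) a single compact [A n0] close to l already
    provides a subsequence along which the values of l are that close to each other. *)
Lemma compact_limit (A : nat -> H -> H) l : (forall n, is_compact_op ip (A n)) ->
  is_bop ip l -> @converges_in R (BH ip) A l -> is_compact_op ip l.
Proof.
move=> cA bl Al; split=> // u [M uM].
have M0 : 0 <= M by apply: le_trans (uM 0%N); exact: hnorm_ge0.
have [|phi iphi phiD] := @diagonal_subsequence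
    (fun k i j => N (l (u i) - l (u j)) < k.+1%:R^-1).
  move=> k psi ipsi; set e := k.+1%:R^-1.
  have e0 : 0 < e by rewrite invr_gt0.
  have M1 : 0 < M + 1 by lra.
  (* Four errors of at most e / 4 add up: two for replacing l by [A n0] on vectors of norm at most
     M, two for the distances to the limit y. *)
  have [n0 /(_ _ (leqnn n0)) /=] := Al _ (divr_gt0 (divr_gt0 e0 (ltr0n R 4)) M1).
  rewrite ltr_pdivlMr// => An.
  have [bAn cAn] := cA n0.
  have [p [ip_ [y py]]] := cAn (u \o psi) (ex_intro _ M (fun n => uM (psi n))).
  have [K Ke] := py _ (divr_gt0 e0 (ltr0n R 4)).
  exists (fun m => p (K + m)%N) => [m|m n]; first by rewrite addnS.
  have := Ke _ (leq_addr m K); have /= := Ke _ (leq_addr n K).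
  set i := psi _; set j := psi _.
  have dist q : N (A n0 (u q) - l (u q)) <= e / 4.
    apply: le_trans (bopP hP (u q) (is_bopB hP bAn bl)) _.
    have := ler_wpM2l (bop_opn_ge0 hP (is_bopB hP bAn bl)) (uM q).
    have := bop_opn_ge0 hP (is_bopB hP bAn bl).
    by move=> *; nra.
  move=> Ai Aj; have := dist i; have := dist j.
  have := ler_hnormB ipP (l (u i)) (A n0 (u i)) (l (u j)).
  have := ler_hnormB ipP (A n0 (u i)) y (l (u j)).
  have := ler_hnormB ipP y (A n0 (u j)) (l (u j)).
  rewrite (hnormB ipP (l (u i)) (A n0 (u i))) (hnormB ipP y (A n0 (u j))).
  by rewrite (hnormB ipP (l (u j)) (l (u i))); move: Ai Aj => /=; lra.
exists phi; split=> //.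
case: hP => _ _ _ _; apply => e e0.
have [K Ke] := invS_lt e0; exists K => m n Km Kn.
by apply: lt_trans (Ke _ (leqnn K)); apply: phiD.
Qed.

Lemma KH_banach : is_banach (KH ip).
Proof.
have [n0 nz ns nt] := BH_banach_norm hP.
split.
- by split; [exact: compact0|exact: compactD].
- exact: compactZ.
- by split=> A [bA _]; [apply: n0|apply: nz].
- by split=> [a A [bA _]|A B [bA _] [bB _]]; [apply: ns|apply: nt].
- move=> u cu uc; have [|l bl ul] := BH_complete hP _ uc; first by move=> n; case: (cu n).
  by exists l => //; apply: compact_limit ul.
Qed.

End CompactOperators.

(** Dependent choice with access to the whole history, as required by Gram-Schmidt and by the greedy
    vectors. *)
Lemma course_of_values_choice (T : Type) (P : seq T -> T -> Prop) :
  (forall l, exists x, P l x) -> exists f : nat -> T, forall n, P (mkseq f n) (f n).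
Proof.
move=> /choice[h hP].
pose L := fix L n := if n is m.+1 then rcons (L m) (h (L m)) else [::].
exists (fun n => h (L n)) => n.
suff -> : mkseq (fun n => h (L n)) n = L n by [].
by elim: n => // n IH; rewrite mkseqS IH.
Qed.

Lemma left_kernel_vector (F : fieldType) m n (M : 'M[F]_(m, n)) : (n < m)%N ->
  exists2 v : 'rV[F]_m, v != 0 & v *m M = 0.
Proof.
move=> nm; have : kermx M != 0.
  rewrite kermx_eq0 /row_free neq_ltn; apply/orP; left.
  exact: leq_ltn_trans (rank_leq_col M) nm.
by case/rowV0Pn => v /sub_kermxP vM v0; exists v.
Qed.

(** * Orthogonal projections and Gram-Schmidt *)

Section Orthosystems.
Variables (R : realType) (H : lmodType R[i]) (ip : H -> H -> R[i]).
Hypothesis ipP : is_inner ip.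
Local Notation N := (hnorm ip).

(* Zero vectors are allowed, so that finite-dimensional spaces and finite
   families need no separate treatment. *)
Definition orthosystem (e : nat -> H) :=
  (forall i j, i != j -> ip (e i) (e j) = 0) /\
  (forall i, e i = 0 \/ ip (e i) (e i) = 1).

Lemma hnorm_sqr_sum (J : eqType) (t : seq J) (P : pred J) (f : J -> H) : uniq t ->
  {in t &, forall i j, i != j -> ip (f i) (f j) = 0} ->
  N (\sum_(i <- t | P i) f i) ^+ 2 = \sum_(i <- t | P i) N (f i) ^+ 2.
Proof.
elim: t => [|a t IH] /=; first by rewrite !big_nil hnorm0// expr0n.
move=> /andP[at_ ut] fo; rewrite !big_cons.
have {}IH := IH ut (fun i j it jt => fo i j (@mem_behead _ (a :: t) i it) (@mem_behead _ (a :: t) j jt)).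
case: (P a) => //; rewrite hnorm_sqrD_ortho// ?IH//.
rewrite ip_sumr// big_seq_cond big1// => j /andP[jt _].
by apply: fo; rewrite ?mem_head ?in_cons ?jt ?orbT//; apply: contraNneq at_ => ->.
Qed.

Lemma hnorm_sqr_sum_ord n (P : pred 'I_n) (f : 'I_n -> H) :
  (forall i j, i != j -> ip (f i) (f j) = 0) ->
  N (\sum_(i < n | P i) f i) ^+ 2 = \sum_(i < n | P i) N (f i) ^+ 2.
Proof. by move=> fo; apply: hnorm_sqr_sum; rewrite ?index_enum_uniq// => i j _ _; apply: fo. Qed.

Section Projections.
Variable e : nat -> H.
Hypothesis eP : orthosystem e.

(** The predicate makes it possible to project on the vectors of one dyadic level only. *)
Definition oproj (n : nat) (P : pred nat) (x : H) : H :=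
  \sum_(i < n | P i) ip x (e i) *: e i.

Lemma ip_mul_ee x j : ip x (e j) * ip (e j) (e j) = ip x (e j).
Proof.
case: eP => _ /(_ j)[->|->]; last by rewrite mulr1.
by rewrite !(ip0r ipP) mul0r.
Qed.

Lemma ip_oproj n P x j : ip (oproj n P x) (e j) = if (j < n)%N && P j then ip x (e j) else 0.
Proof.
rewrite /oproj ip_suml//; case: ifPn => [/andP[jn Pj]|].
  rewrite (bigD1 (Ordinal jn))//= ipZl// ip_mul_ee big1 ?addr0// => i /andP[_ ij].
  by rewrite ipZl// eP.1 ?mulr0.
rewrite negb_and => nj; rewrite big1// => i Pi; rewrite ipZl// eP.1 ?mulr0//.
by apply/negP => /eqP ij; move: nj; rewrite -ij ltn_ord Pi.
Qed.

Lemma ip_oproj_r n P x y : ip y (oproj n P x) = \sum_(i < n | P i) conjc (ip x (e i)) * ip y (e i).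
Proof. by rewrite /oproj ip_sumr//; apply: eq_bigr => i _; rewrite ipZr. Qed.

Lemma oproj_ortho_compl n P x : ip (x - oproj n P x) (oproj n P x) = 0.
Proof.
rewrite ip_oproj_r big1// => i Pi.
by rewrite ipBl// ip_oproj ltn_ord Pi subrr mulr0.
Qed.

Lemma oproj_ortho n (P Q : pred nat) x : (forall i, (i < n)%N -> P i -> ~~ Q i) ->
  ip (oproj n P x) (oproj n Q x) = 0.
Proof.
move=> PQ; rewrite ip_oproj_r big1// => i Qi; rewrite ip_oproj ltn_ord /=.
by case: ifP => [/(PQ _ (ltn_ord i))|]; rewrite ?Qi// mulr0.
Qed.

Lemma oproj_pythagoras n P x : N x ^+ 2 = N (x - oproj n P x) ^+ 2 + N (oproj n P x) ^+ 2.
Proof. by rewrite -{1}[x](subrK (oproj n P x)) (hnorm_sqrD_ortho ipP (oproj_ortho_compl n P x)). Qed.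

Lemma oproj_compl_le n P x : N (x - oproj n P x) <= N x.
Proof.
rewrite -(ler_pXn2r (n := 2)) ?nnegrE ?hnorm_ge0//.
by rewrite [leRHS](oproj_pythagoras n P) lerDl sqr_ge0.
Qed.

Lemma oproj_le n P x : N (oproj n P x) <= N x.
Proof.
rewrite -(ler_pXn2r (n := 2)) ?nnegrE ?hnorm_ge0//.
by rewrite [leRHS](oproj_pythagoras n P) lerDr sqr_ge0.
Qed.

Lemma oproj_selfadjoint n P x y : ip (oproj n P x) y = ip x (oproj n P y).
Proof.
rewrite ip_oproj_r /oproj ip_suml//; apply: eq_bigr => i _.
by rewrite ipZl// mulrC (ipC ipP y).
Qed.

Lemma oproj_id m n x : (m <= n)%N -> x = oproj m predT x -> oproj n predT x = x.
Proof.
move=> mn xm; apply/eqP; rewrite eq_sym -subr_eq0; apply/eqP.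
have ux : ip (x - oproj n predT x) x = 0.
  rewrite {3}xm ip_oproj_r big1// => i _.
  by rewrite ipBl// ip_oproj (leq_trans (ltn_ord i) mn) subrr mulr0.
by case: ipP => _ _ _; apply; rewrite ipBr// ux oproj_ortho_compl subr0.
Qed.

End Projections.

(** If [g n] depends on its predecessors, its residual [f n] is 0; then [e n] = 0, one of the zero
    vectors that [orthosystem] admits. *)
Lemma gram_schmidt (g : nat -> H) : exists2 e, orthosystem e &
  forall n, g n = oproj e n.+1 predT (g n).
Proof.
pose r (l : seq H) := g (size l) - \sum_(y <- l) ip (g (size l)) y *: y.
have [e eE] := course_of_values_choice
  (fun l => ex_intro (fun x => x = (((N (r l))^-1%:C)%C *: r l)) _ erefl).
pose f n := r (mkseq e n).
have {}eE n : e n = ((N (f n))^-1%:C)%C *: f n by rewrite eE.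
have fE n : f n = g n - oproj e n predT (g n).
  by rewrite /f /r size_mkseq /mkseq big_map -[X in iota 0 X](subn0 n) big_mkord.
have ee i : e i = 0 \/ ip (e i) (e i) = 1.
  have [f0|f0] := eqVneq (f i) 0; first by left; rewrite eE f0 scaler0.
  right; rewrite eE ipxx// hnormZ// cabs_real ger0_norm ?invr_ge0 ?hnorm_ge0//.
  by rewrite mulVf ?expr1n// gt_eqF// hnorm_gt0.
(* Strong induction, since the cross terms pair [e i] with [e m] for i and m both below n, in either
   order. *)
have lo n : forall m, (m < n)%N -> ip (e n) (e m) = 0.
  elim/ltn_ind: n => n IH m mn.
  rewrite (eE n) ipZl// fE ipBl// [ip (oproj _ _ _ _) _]ip_suml//.
  rewrite (bigD1 (Ordinal mn))//= ipZl// big1 ?addr0; last first.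
    move=> i im; rewrite ipZl//.
    have [/(IH _ (ltn_ord i)) ->|] := ltnP m i; first by rewrite mulr0.
    rewrite leq_eqVlt => /orP[/eqP im'|/(IH _ mn)]; last first.
      by rewrite (ipC ipP (e i)) => /(congr1 conjc); rewrite conjcK conjc0 => ->; rewrite mulr0.
    by case/negP: im; apply/eqP/val_inj.
  case: (ee m) => [->|->]; first by rewrite !(ip0r ipP) mulr0 subrr mulr0.
  by rewrite mulr1 subrr mulr0.
have eo : orthosystem e.
  split=> // i j ij; have [ji|] := ltnP j i; first exact: lo.
  rewrite leq_eqVlt (negPf ij) => /lo ji.
  by rewrite (ipC ipP) ji conjc0.
exists e => // n; rewrite /oproj big_ord_recr /= -/(oproj e n predT (g n)).
have -> : ip (g n) (e n) = ((N (f n))%:C)%C.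
  rewrite -[g n](subrK (oproj e n predT (g n))) ipDl// (ip_oproj eo) ltnn addr0 -fE.
  rewrite eE ipZr// conjc_real ipxx// -rmorphM /=; congr (_%:C)%C.
  have [->|f0] := eqVneq (N (f n)) 0; first by rewrite expr0n mulr0.
  by rewrite expr2 mulKf.
have [f0|f0] := eqVneq (f n) 0.
  by rewrite f0 hnorm0// scale0r addr0; move/eqP: f0; rewrite fE subr_eq0 => /eqP.
rewrite [in X in _ + X]eE scalerA -rmorphM /= mulfV ?gt_eqF ?hnorm_gt0//.
by rewrite scale1r fE addrC subrK.
Qed.

End Orthosystems.

(** * Greedy vectors and singular numbers *)

Section SingularNumbers.
Variables (R : realType) (H : lmodType R[i]) (ip : H -> H -> R[i]).
Hypothesis hP : is_hilbert ip.
Local Notation N := (hnorm ip).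
Local Notation hs := (hspace ip).
Local Notation opn := (@opnorm R hs hs).
Local Notation rklt := (@rank_lt R hs hs).
Let ipP := hilbert_inner hP.

Lemma rank_lt0 k : rklt 0 k.+1.
Proof. by exists [::]; split=> // x _; exists (fun=> 0); rewrite big_ord0. Qed.

Lemma sing_le A F k : is_bop ip A -> is_bop ip F -> rklt F k.+1 ->
  sing ip A k <= opn (A - F).
Proof.
move=> bA bF rF; apply: ge_inf; last by exists F.
by exists 0 => _ [G [bG _] <-]; apply: (bop_opn_ge0 hP); apply: is_bopB.
Qed.

Lemma le_sing A k (c : R) : (forall F, is_bop ip F -> rklt F k.+1 -> c <= opn (A - F)) ->
  c <= sing ip A k.
Proof.
move=> cF; apply: lb_le_inf => [|_ [F [bF rF] <-]]; last exact: cF.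
by exists (opn (A - 0)); exists 0 => //; split; [exact: is_bop0|exact: rank_lt0].
Qed.

Lemma sing_ge0 A k : is_bop ip A -> 0 <= sing ip A k.
Proof. by move=> bA; apply: le_sing => F bF _; apply: (bop_opn_ge0 hP); apply: is_bopB. Qed.

Lemma sing_lt A k (c : R) : sing ip A k < c ->
  exists F, [/\ is_bop ip F, rklt F k.+1 & opn (A - F) < c].
Proof.
case/inf_lt => [|_ [F [bF rF] <-] Fc]; last by exists F.
by exists (opn (A - 0)); exists 0 => //; split; [exact: is_bop0|exact: rank_lt0].
Qed.

Lemma sing_mono A k l : is_bop ip A -> (k <= l)%N -> sing ip A l <= sing ip A k.
Proof.
move=> bA kl; apply: le_sing => F bF [s [sk sF]]; apply: sing_le => //.
by exists s; split=> //; apply: leq_trans sk _.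
Qed.

Lemma is_bop_oproj e n P : orthosystem ip e -> is_bop ip (oproj ip e n P).
Proof.
move=> eo; apply: (@is_bopP _ _ _ _ 1) => [x y|a x|x].
- by rewrite /oproj -big_split; apply: eq_bigr => i _; rewrite ipDl// scalerDl.
- by rewrite /oproj scaler_sumr; apply: eq_bigr => i _; rewrite ipZl// scalerA.
- by rewrite mul1r; apply: oproj_le.
Qed.

(** The factor 2 arises because the supremum of |C x| need not be attained: z only has to reach half
    of it. *)
Lemma greedy_step C (bC : is_bop ip C) (l : seq H) : exists z,
  [/\ forall y, y \in l -> ip z y = 0, z = 0 \/ ip z z = 1 &
      forall x, (forall y, y \in l -> ip x y = 0) -> N (C x) <= 2 * N (C z) * N x].
Proof.
pose S := [set N (C x) | x in [set x | (forall y, y \in l -> ip x y = 0) /\ N x <= 1]].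
have ubS : has_ubound S.
  exists (opn C) => _ [x [_ x1] <-]; apply: le_trans (bopP hP x bC) _.
  by rewrite -[leRHS]mulr1 ler_wpM2l// (bop_opn_ge0 hP).
have supS x : (forall y, y \in l -> ip x y = 0) -> N (C x) <= sup S * N x.
  move=> xl; have [->|x0] := eqVneq x 0.
    by rewrite (bop0 bC) hnorm0// mulr0.
  have xp := hnorm_gt0 ipP x0; rewrite -ler_pdivrMr//; apply: ub_le_sup => //.
  exists (((N x)^-1%:C)%C *: x) => /=.
    split=> [y /xl|]; first by rewrite ipZl// => ->; rewrite mulr0.
    by rewrite hnormZ// cabs_real ger0_norm ?invr_ge0 ?hnorm_ge0// mulVf// gt_eqF.
  by rewrite (bopZ bC) hnormZ// cabs_real ger0_norm ?invr_ge0 ?hnorm_ge0// mulrC.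
(* If C vanishes on the orthogonal complement of l, in particular if this complement is zero, z = 0
   is taken. *)
have [S0|S0] := leP (sup S) 0.
  exists 0; split=> [y _||x /supS]; [by rewrite ip0l|by left|].
  rewrite (bop0 bC) hnorm0// mulr0 mul0r => /le_trans; apply.
  by rewrite mulr_le0_ge0 ?hnorm_ge0.
have : sup S / 2 < sup S by lra.
case/sup_gt => [|_ [x [xl x1] <-] Sx].
  by exists (N (C 0)), 0 => //=; split=> [y _|]; rewrite ?ip0l// hnorm0.
have x0 : x != 0.
  by apply: contraTneq Sx => ->; rewrite (bop0 bC) hnorm0// -leNgt; lra.
have xp := hnorm_gt0 ipP x0.
exists (((N x)^-1%:C)%C *: x); split=> [y /xl||y /supS].
- by rewrite ipZl// => ->; rewrite mulr0.
- right; rewrite ipxx// hnormZ// cabs_real ger0_norm ?invr_ge0 ?hnorm_ge0//.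
  by rewrite mulVf ?expr1n// gt_eqF.
move/le_trans; apply; apply: ler_wpM2r; first exact: hnorm_ge0.
rewrite (bopZ bC) hnormZ// cabs_real ger0_norm ?invr_ge0 ?hnorm_ge0//.
(* Normalising x, whose norm is at most 1, can only increase |C x|. *)
have : N (C x) <= (N x)^-1 * N (C x).
  by rewrite ler_peMl ?hnorm_ge0// invf_ge1.
by lra.
Qed.

(* Greedy maximisation of |C z| under the constraints z _|_ z_j and
   C z _|_ C z_j; the vectors e orthonormalise the constraints, of which there
   are two per step. *)
Lemma greedy_vectors C : is_bop ip C -> exists z e,
  [/\ orthosystem ip z, forall i j, i != j -> ip (C (z i)) (C (z j)) = 0,
      orthosystem ip e &
      forall n x, (forall i, (i < n.*2)%N -> ip x (e i) = 0) ->
        N (C x) <= 2 * N (C (z n)) * N x] /\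
  forall j n, (j <= n)%N -> N (C (z n)) <= 2 * N (C (z j)).
Proof.
move=> bC; have [D bD CD] := adjoint hP bC.
have [z zP] := course_of_values_choice
  (fun l => greedy_step bC (l ++ [seq D (C y) | y <- l])).
have con n x : (forall j, (j < n)%N -> ip x (z j) = 0 /\ ip x (D (C (z j))) = 0) ->
    forall y, y \in mkseq z n ++ [seq D (C y) | y <- mkseq z n] -> ip x y = 0.
  move=> xz y; rewrite mem_cat => /orP[/mapP[j]|/mapP[_ /mapP[j + ->] ->]].
    by rewrite mem_iota => /andP[_ jn] ->; have [] := xz j jn.
  by rewrite mem_iota => /andP[_ jn]; have [] := xz j jn.
have zz i j : (j < i)%N -> ip (z i) (z j) = 0 /\ ip (z i) (D (C (z j))) = 0.
  move=> ji; have [zo _ _] := zP i.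
  have jm : z j \in mkseq z i by apply/mapP; exists j; rewrite ?mem_iota.
  by split; apply: zo; rewrite mem_cat ?jm// map_f ?orbT.
have zC i j : i != j -> ip (C (z i)) (C (z j)) = 0.
  rewrite neq_ltn => /orP[] /zz[_]; rewrite -CD// => zij.
  by rewrite (ipC ipP) zij conjc0.
have zo : orthosystem ip z.
  split=> [i j|i]; last by have [] := zP i.
  by rewrite neq_ltn => /orP[] /zz[zij _] //; rewrite (ipC ipP) zij conjc0.
(* Interleaving the two kinds of constraints makes the first 2n vectors of [e] span exactly the
   constraints of the first n steps. *)
pose g i := if odd i then D (C (z i./2)) else z i./2.
have [e eo ge] := gram_schmidt ipP g.
exists z, e; split; first split=> //.
  move=> n x xe; have [_ _] := zP n; apply.
  have xg i : (i < n.*2)%N -> ip x (g i) = 0.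
    move=> i_n; rewrite ge ip_oproj_r// big1// => j _.
    by rewrite xe ?mulr0// (leq_ltn_trans _ i_n)// -ltnS ltn_ord.
  apply: con => j jn; split.
    have := xg j.*2; rewrite ltn_double => /(_ jn).
    by rewrite /g odd_double doubleK.
  have := xg j.*2.+1; rewrite ltn_Sdouble => /(_ jn).
  by rewrite /g /= odd_double /= uphalf_double.
(* The constraints only grow, so z_n was admissible at step j and cannot beat z_j by more than the
   factor 2. *)
move=> j n; rewrite leq_eqVlt => /orP[/eqP ->|jn].
  by have := hnorm_ge0 ip (C (z n)); lra.
have [_ _ /(_ (z n))] := zP j.
have zn1 : N (z n) <= 1.
  case: zo => _ /(_ n)[->|z1]; first by rewrite hnorm0.
  by rewrite /hnorm z1 /= sqrtr1.
move=> /(_ _)/le_trans; apply.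
  by apply: con => i ij; apply: zz; apply: ltn_trans ij jn.
by rewrite ler_piMr// mulr_ge0 ?hnorm_ge0.
Qed.

(** An F of rank at most n kills a nontrivial combination y of the n + 1 vectors. Orthogonality of
    the images gives |C y| >= nu |y|, hence |C - F| >= nu. *)
Lemma sing_ge_ortho C n (nu : R) (x : nat -> H) : is_bop ip C -> 0 <= nu ->
  (forall i j, (i <= n)%N -> (j <= n)%N -> ip (x i) (x j) = (i == j)%:R) ->
  (forall i j, i != j -> ip (C (x i)) (C (x j)) = 0) ->
  (forall i, (i <= n)%N -> nu <= N (C (x i))) -> nu <= sing ip C n.
Proof.
move=> bC nu0 xo Co Cnu; apply: le_sing => F bF [s [sn sF]].
have /choice[c cP] : forall j : 'I_n.+1, exists c : nat -> R[i],
    F (x j) = \sum_(i < size s) c i *: s`_i by move=> j; apply: sF.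
have [a a0 aM] := left_kernel_vector (\matrix_(j < n.+1, i < size s) c j i) sn.
pose y := \sum_(j < n.+1) a 0 j *: x j.
have Fy : F y = 0.
  rewrite /y (bop_sum bF).
  under eq_bigr do rewrite (bopZ bF) cP scaler_sumr.
  rewrite exchange_big big1//= => i _.
  under eq_bigr do rewrite scalerA.
  rewrite -scaler_suml; move/matrixP/(_ 0 i): aM; rewrite !mxE.
  by under eq_bigr do rewrite mxE; move=> ->; rewrite scale0r.
have ord_ne (i j : 'I_n.+1) : i != j -> (i : nat) != j by [].
have Ny : N y ^+ 2 = \sum_(j < n.+1) cabs (a 0 j) ^+ 2.
  rewrite hnorm_sqr_sum_ord//.
    apply: eq_bigr => j _; rewrite hnormZ// exprMn hnorm_sqr// xo -1?ltnS ?ltn_ord//.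
    by rewrite eqxx mulr1.
  move=> i j ij; rewrite ipZl// ipZr// xo -1?ltnS ?ltn_ord//.
  by rewrite (negPf (ord_ne _ _ ij)) !mulr0.
have NCy : nu ^+ 2 * N y ^+ 2 <= N (C y) ^+ 2.
  have -> : C y = \sum_(j < n.+1) a 0 j *: C (x j).
    by rewrite /y (bop_sum bC); apply: eq_bigr => j _; rewrite (bopZ bC).
  rewrite [leRHS]hnorm_sqr_sum_ord//; last first.
    by move=> i j ij; rewrite ipZl// ipZr// Co ?mulr0// ord_ne.
  rewrite Ny mulr_sumr; apply: ler_sum => j _.
  rewrite hnormZ// exprMn mulrC ler_wpM2l ?sqr_ge0//.
  by rewrite ler_pXn2r ?nnegrE ?hnorm_ge0// Cnu// -ltnS.
have y0 : 0 < N y.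
  rewrite lt_neqAle hnorm_ge0 andbT; apply: contraNneq a0 => y0.
  apply/eqP/rowP => j; rewrite mxE; apply: cabs_eq0; apply/eqP; rewrite -sqrf_eq0.
  move/eqP: Ny; rewrite -y0 expr0n /= eq_sym psumr_eq0; last by move=> *; exact: sqr_ge0.
  by move/allP/(_ j (mem_index_enum j)).
rewrite -(ler_pM2r y0); apply: le_trans (bopP hP y (is_bopB hP bC bF)).
rewrite !fctE Fy subr0 -(ler_pXn2r (n := 2)) ?nnegrE ?mulr_ge0 ?hnorm_ge0//.
by rewrite exprMn.
Qed.

Lemma orthosystem_orthonormal (z : nat -> H) n : orthosystem ip z ->
  (forall i, (i <= n)%N -> z i != 0) ->
  forall i j, (i <= n)%N -> (j <= n)%N -> ip (z i) (z j) = (i == j)%:R.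
Proof.
move=> [zo z1] z0 i j i_n jn; have [->|/zo//] := eqVneq i j.
by case: (z1 j) => // /eqP; rewrite (negPf (z0 j jn)).
Qed.

(** With n = k/2, the vectors e_i with i < k contain the constraints of n greedy steps. The constant
    4 combines the greedy factor 2 with |C z_n| <= 2 a_n, which is [sing_ge_ortho] for the vectors
    z_0, ..., z_n, whose images have norm at least |C z_n| / 2. *)
Lemma orthosystem_approx C : is_bop ip C -> exists2 e, orthosystem ip e &
  forall k x, (forall i, (i < k)%N -> ip x (e i) = 0) ->
    N (C x) <= 4 * sing ip C k./2 * N x.
Proof.
move=> bC; have [z [e [[zo zC eo eP] zm]]] := greedy_vectors bC.
exists e => // k x xe.
have kk : (k./2.*2 <= k)%N by rewrite -{2}(odd_double_half k) leq_addl.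
apply: le_trans (eP k./2 x (fun i ik => xe i (leq_trans ik kk))) _.
apply: ler_wpM2r; first exact: hnorm_ge0.
set n := k./2; have sn0 := sing_ge0 n bC.
suff : N (C (z n)) / 2 <= sing ip C n by lra.
have [Cn0|Cn0] := leP (N (C (z n))) 0; first by lra.
apply: (sing_ge_ortho (x := z)) => //; first by lra.
  apply: orthosystem_orthonormal => // i /zm Cni; apply: contraTneq Cn0 => zi0.
  by rewrite -leNgt; apply: le_trans Cni _; rewrite zi0 (bop0 bC) hnorm0// mulr0.
by move=> i /zm; lra.
Qed.

(** Restricting C to the span of the 2n constraints is an approximation of rank at most 2n, so a_2n
    <= 2 |C z_n| <= 4 |C z_i|. Positivity of a_2n makes the z_i nonzero, hence orthonormal. *)
Lemma sing_ortho_vectors C n : is_bop ip C -> 0 < sing ip C n.*2 ->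
  exists x : nat -> H,
  [/\ forall i j, (i <= n)%N -> (j <= n)%N -> ip (x i) (x j) = (i == j)%:R,
      forall i j, i != j -> ip (C (x i)) (C (x j)) = 0 &
      forall i, (i <= n)%N -> sing ip C n.*2 / 4 <= N (C (x i))].
Proof.
move=> bC sn0; have [z [e [[zo zC eo eP] zm]]] := greedy_vectors bC.
have sz : sing ip C n.*2 <= 2 * N (C (z n)).
  have bF : is_bop ip (C \o oproj ip e n.*2 predT).
    by apply: is_bop_comp => //; apply: is_bop_oproj.
  apply: (le_trans (sing_le bC bF _)).
    exists (mkseq (C \o e) n.*2); rewrite size_mkseq; split=> // x _.
    exists (fun i => ip x (e i)); rewrite /= /oproj (bop_sum bC).
    by apply: eq_bigr => i _; rewrite nth_mkseq// (bopZ bC).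
  apply: (bop_opn_le hP); first by rewrite mulr_ge0 ?hnorm_ge0.
  move=> x; rewrite !fctE /= -(bopB bC).
  apply: le_trans (eP n _ _) _ => [i i_n|].
    by rewrite ipBl// ip_oproj// i_n subrr.
  by rewrite ler_wpM2l ?mulr_ge0 ?hnorm_ge0// oproj_compl_le.
have zn i : (i <= n)%N -> sing ip C n.*2 / 4 <= N (C (z i)) by move/zm; lra.
exists z; split=> //; apply: orthosystem_orthonormal => // i /zn.
by apply: contraTneq => ->; rewrite (bop0 bC) hnorm0// -ltNge divr_gt0.
Qed.

(** The adjoint of an approximant F approximates B equally well. It has no larger rank: F = P F for
    the projection P on a space containing its range, so the adjoint of F factors through P. *)
Lemma sing_adjoint_le A B k : is_bop ip A -> is_bop ip B ->
  (forall x y, ip (A x) y = ip x (B y)) -> sing ip B k <= sing ip A k.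
Proof.
move=> bA bB AB; apply: le_sing => F bF [s [sk sF]].
have [G bG FG] := adjoint hP bF.
have [e eo es] := gram_schmidt ipP (fun i => s`_i).
have bP := is_bop_oproj (size s) predT eo.
have PF x : oproj ip e (size s) predT (F x) = F x.
  have [c ->] := sF x I; rewrite (bop_sum bP); apply: eq_bigr => i _.
  by rewrite (bopZ bP) (oproj_id ipP eo (ltn_ord i) (es i)).
have GE y : G y = G (oproj ip e (size s) predT y).
  apply: (ip_inj ipP) => x; rewrite !(ipC ipP x) -!FG; congr conjc.
  by rewrite -[in LHS]PF oproj_selfadjoint.
apply: (le_trans (sing_le bB bG _)).
  exists (mkseq (G \o e) (size s)); rewrite size_mkseq; split=> // x _.
  exists (fun i => ip x (e i)); rewrite GE /oproj (bop_sum bG).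
  by apply: eq_bigr => i _; rewrite nth_mkseq// (bopZ bG).
apply: (bop_opn_le hP); first exact/(bop_opn_ge0 hP)/is_bopB.
move=> y; apply: (hnorm_le_dual ipP).
  by rewrite mulr_ge0 ?hnorm_ge0//; apply/(bop_opn_ge0 hP)/is_bopB.
move=> x; rewrite (ipC ipP x) cabsJ !fctE ipBr// -AB -FG -ipBl//.
apply: le_trans (cauchy_schwarz ipP _ _) _.
by rewrite mulrAC ler_wpM2r ?hnorm_ge0//; apply: (bopP hP x (is_bopB hP bA bF)).
Qed.

Lemma orthosystem_approx_adjoint A B : is_bop ip A -> is_bop ip B ->
  (forall x y, ip (A x) y = ip x (B y)) ->
  exists2 e, orthosystem ip e &
  forall k x, (forall i, (i < k)%N -> ip x (e i) = 0) ->
    N (B x) <= 4 * sing ip A k./2 * N x.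
Proof.
move=> bA bB AB; have [e eo eB] := orthosystem_approx bB; exists e => // k x xe.
apply: le_trans (eB k x xe) _; apply: ler_wpM2r; first exact: hnorm_ge0.
by rewrite ler_wpM2l// sing_adjoint_le.
Qed.

End SingularNumbers.

Lemma fresh_nat (F : seq nat) : exists k, k \notin F.
Proof.
apply: contrapT => nF.
have FA k : k \in F by apply: contrapT => /negP kF; apply: nF; exists k.
have := uniq_leq_size (iota_uniq 0 (size F).+1) (fun k _ => FA k).
by rewrite size_iota ltnn.
Qed.

(** * Calkin spaces: solidity, dilation, tensor products *)

Section CalkinSpaces.
Variables (R : realType).
Implicit Types (a b : nat -> R[i]) (u v : nat -> R).

(** Empty and unbounded sets are included, where [sup] takes the default value 0. *)
Lemma sup_ge0 (E : set R) : (forall x, E x -> 0 <= x) -> 0 <= sup E.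
Proof.
move=> E0; have [hE|hE] := pselect (has_sup E); last by rewrite sup_out.
have [[x Ex] ub] := hE; exact: le_trans (E0 x Ex) (ub_le_sup ub Ex).
Qed.

Lemma c0_bounded a : c0 a -> exists M, forall k, cabs (a k) <= M.
Proof.
move=> /(_ 1 ltr01)[K K1]; exists (1 + \sum_(i < K) cabs (a i)) => k.
have S0 : 0 <= \sum_(i < K) cabs (a i) by apply: sumr_ge0 => i _; exact: cabs_ge0.
have [kK|/K1] := ltnP k K; last by lra.
rewrite (bigD1 (Ordinal kK))//= addrCA lerDl addr_ge0// sumr_ge0// => i _.
exact: cabs_ge0.
Qed.

(** The comparison of b with a may shift indices: after deleting F from a, a set F' no larger is
    deleted from b. This covers termwise domination as well as insertion of zeros. *)
Lemma rearr_le a b : c0 a ->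
  (forall F : seq nat, exists2 F' : seq nat, (size F' <= size F)%N &
    forall k, k \notin F' -> exists2 k', k' \notin F & cabs (b k) <= cabs (a k')) ->
  forall n, rearr b n <= rearr a n.
Proof.
move=> /c0_bounded[M aM] ab n; apply: lb_le_inf.
  by exists (sup [set cabs (a k) | k in [set k | k \notin [::]]]); exists [::].
move=> _ [F Fn <-]; have [F' F'F bF] := ab F.
apply: (@le_trans _ _ (sup [set cabs (b k) | k in [set k | k \notin F']])).
  apply: ge_inf; last by exists F' => //=; apply: leq_trans F'F Fn.
  by exists 0 => _ [G _ <-]; apply: sup_ge0 => _ [k _ <-]; exact: cabs_ge0.
apply: ge_sup.
  by have [k kF] := fresh_nat F'; exists (cabs (b k)), k.
move=> _ [k /= kF' <-]; have [k' k'F /le_trans] := bF k kF'; apply.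
by apply: ub_le_sup; [exists M => _ [j _ <-]|exists k'].
Qed.

Variable I : set (nat -> R[i]).
Hypothesis IP : is_calkin I.

Lemma calkin_c0 a : I a -> c0 a.
Proof. by case: IP => _ _ _ + _; apply. Qed.

Lemma calkin_dom a b : I a -> (forall n, cabs (b n) <= cabs (a n)) -> I b.
Proof.
move=> Ia ba; have ca := calkin_c0 Ia; case: IP => _ _ _ _; apply; first exact: Ia.
  by move=> e /ca[K Ke]; exists K => n /Ke; apply: le_lt_trans.
by apply: rearr_le => // F; exists F => // k kF; exists k.
Qed.

(** Repeating every term twice is the sum of two copies of a, one on the even and one on the odd
    positions, each with zeros inserted. *)
Lemma calkin_half a : I a -> I (fun n => a n./2).
Proof.
move=> Ia; have ca := calkin_c0 Ia.
pose b (p : bool) n := if odd n == p then a n./2 else 0.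
have Ib p : I (b p).
  case: (IP) => _ _ _ _; apply; first exact: Ia.
    move=> e e0; have [K Ke] := ca e e0; exists K.*2 => n Kn; rewrite /b.
    by case: ifP => _; rewrite ?cabs0//; apply: Ke; rewrite -(doubleK K) half_leq.
  apply: rearr_le => // F; exists [seq (p + m.*2)%N | m <- F]; first by rewrite size_map.
  move=> k kF; rewrite /b; case: eqP => [ok|_]; last first.
    by have [k' k'F] := fresh_nat F; exists k' => //; rewrite cabs0 cabs_ge0.
  exists k./2 => //; apply: contraNN kF => kF; apply/mapP; exists k./2 => //.
  by rewrite -ok odd_double_half.
have -> : (fun n => a n./2) = b true + b false.
  by apply/funext => n; rewrite !fctE /b; case: (odd n); rewrite /= ?addr0 ?add0r.
by case: IP => _ + _ _ _; apply.
Qed.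

Lemma calkin_le u v : I (cseq u) -> (forall n, 0 <= v n) -> (forall n, v n <= u n) ->
  I (cseq v).
Proof.
move=> Iu v0 vu; apply: (calkin_dom Iu) => n; rewrite !cabs_real !ger0_norm//.
exact: le_trans (v0 n) (vu n).
Qed.

Lemma calkinD u v : I (cseq u) -> I (cseq v) -> I (cseq (fun n => u n + v n)).
Proof.
move=> Iu Iv; have -> : cseq (fun n => u n + v n) = cseq u + cseq v.
  by apply/funext => n; rewrite fctE /cseq rmorphD.
by case: IP => _ + _ _ _; apply.
Qed.

Lemma calkinZ (c : R) u : I (cseq u) -> I (cseq (fun n => c * u n)).
Proof.
move=> Iu; have -> : cseq (fun n => c * u n) = (c%:C)%C *: cseq u.
  by apply/funext => n; rewrite fctE /cseq rmorphM.
by case: IP => _ _ + _ _; apply.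
Qed.

Lemma calkin0 : I (cseq (fun=> 0)).
Proof. by case: IP. Qed.

(** The exceptional set of at most n pairs will index the rank one terms of the approximant of
    M_{A,B}. *)
Lemma tens_lt u v (mu : R) n : (forall n, 0 <= u n) -> (forall n, 0 <= v n) ->
  I (cseq u) -> I (cseq v) ->
  complex.Re (tens (cseq u) (cseq v) n) < mu ->
  exists2 F : seq (nat * nat), (size F <= n)%N &
    forall i j, (i, j) \notin F -> u i * v j < mu.
Proof.
move=> u0 v0 /calkin_c0/c0_bounded[M uM] /calkin_c0/c0_bounded[L vL] /inf_lt[].
  by eexists; exists [::].
move=> _ [F Fn <-] Fmu; exists F => // i j ijF; apply: le_lt_trans Fmu.
apply: ub_le_sup; last first.
  exists (i, j); first exact: ijF.
  by rewrite cabsM /cseq !cabs_real !ger0_norm.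
exists (M * L) => _ [[p q] _ <-]; rewrite cabsM.
by apply: ler_pM; rewrite ?cabs_ge0.
Qed.

Lemma tens_Re_ge0 a b n : 0 <= complex.Re (tens a b n).
Proof.
apply: lb_le_inf; first by eexists; exists [::].
by move=> _ [F _ <-]; apply: sup_ge0 => _ [p _ <-]; exact: cabs_ge0.
Qed.

Lemma stable_tens a b : stable I -> I a -> I b -> I (tens a b).
Proof.
by rewrite /stable => sI Ia Ib; rewrite -sI => J _; apply.
Qed.

End CalkinSpaces.

(** * Operators whose approximation numbers are dominated in the Calkin space *)

Section Approximable.
Variables (R : realType) (I : set (nat -> R[i])).
Hypothesis IP : is_calkin I.

(** The slack e accounts for approximation numbers being infima that need not be attained. The
    definition makes sense both on H and on spaces of operators, so that sums and multiples are
    treated once. *)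
Definition approximable (X Y : nspace R) (T : nsV X -> nsV Y) : Prop :=
  exists u : nat -> R, [/\ forall n, 0 <= u n, I (cseq u) &
  forall n e, 0 < e -> exists F : nsV X -> nsV Y,
    [/\ bounded_op F, rank_lt F n.+1 &
        forall x, nsdom X x -> nsnorm Y (T x - F x) <= (u n + e) * nsnorm X x]].

Variables (X Y : nspace R).
Hypotheses (bX : is_banach X) (bY : is_banach Y).
Implicit Types (S T F : nsV X -> nsV Y).

Lemma banach_normD y z : nsdom Y y -> nsdom Y z -> nsnorm Y (y + z) <= nsnorm Y y + nsnorm Y z.
Proof. by case: bY => _ _ _ [_ +] _; apply. Qed.

Lemma banach_normZ a y : nsdom Y y -> nsnorm Y (a *: y) = cabs a * nsnorm Y y.
Proof. by case: bY => _ _ _ [+ _] _; apply. Qed.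

Lemma banach_domD y z : nsdom Y y -> nsdom Y z -> nsdom Y (y + z).
Proof. by case: bY => [[_ +] _ _ _ _]; apply. Qed.

Lemma banach_domZ a y : nsdom Y y -> nsdom Y (a *: y).
Proof. by case: bY => _ + _ _ _; apply. Qed.

Lemma banach_domB y z : nsdom Y y -> nsdom Y z -> nsdom Y (y - z).
Proof. by move=> dy dz; rewrite -scaleN1r; apply: banach_domD => //; apply: banach_domZ. Qed.

Lemma bounded_opD S T : bounded_op S -> bounded_op T -> bounded_op (fun x => S x + T x).
Proof.
move=> [Sd SD SZ [M SM]] [Td TD TZ [L TL]]; split.
- by move=> x dx; apply: banach_domD; [exact: Sd|exact: Td].
- by move=> x y dx dy; rewrite SD// TD// addrACA.
- by move=> a x dx; rewrite SZ// TZ// scalerDr.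
- exists (M + L) => x dx; rewrite mulrDl; apply: le_trans (banach_normD _ _) _.
  + exact: Sd.
  + exact: Td.
  + by apply: lerD; [exact: SM|exact: TL].
Qed.

Lemma bounded_opZ a T : bounded_op T -> bounded_op (fun x => a *: T x).
Proof.
move=> [Td TD TZ [L TL]]; split.
- by move=> x dx; apply: banach_domZ; exact: Td.
- by move=> x y dx dy; rewrite TD// scalerDr.
- by move=> b x dx; rewrite TZ// !scalerA mulrC.
- exists (cabs a * L) => x dx; rewrite banach_normZ; last exact: Td.
  by rewrite -mulrA ler_wpM2l ?cabs_ge0//; exact: TL.
Qed.

Lemma rank_ltD S T m n : rank_lt S m.+1 -> rank_lt T n.+1 ->
  rank_lt (fun x => S x + T x) (m + n).+1.
Proof.
move=> [s [sm sS]] [t [tn tT]]; exists (s ++ t); split.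
  by rewrite size_cat ltnS leq_add.
move=> x dx; have [c ->] := sS x dx; have [d ->] := tT x dx.
exists (fun i => if (i < size s)%N then c i else d (i - size s)%N).
rewrite size_cat big_split_ord /=; congr (_ + _); apply: eq_bigr => i _.
  by rewrite nth_cat ltn_ord.
by rewrite nth_cat ltnNge leq_addr /= addKn.
Qed.

Lemma rank_ltZ a T n : rank_lt T n -> rank_lt (fun x => a *: T x) n.
Proof.
move=> [s [sn sT]]; exists s; split=> // x dx; have [c ->] := sT x dx.
by exists (fun i => a * c i); rewrite scaler_sumr; apply: eq_bigr => i _; rewrite scalerA.
Qed.

Lemma rank_lt_leq T m n : (m <= n)%N -> rank_lt T m -> rank_lt T n.
Proof. by move=> mn [s [sm sT]]; exists s; split=> //; apply: leq_trans sm mn. Qed.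

Lemma approximable_ext S T : (forall x, nsdom X x -> S x = T x) ->
  approximable S -> approximable T.
Proof.
move=> ST [u [u0 Iu uF]]; exists u; split=> // n e /uF-/(_ n)[F [bF rF Fu]].
by exists F; split=> // x dx; rewrite -ST//; exact: Fu.
Qed.

Lemma approximableD S T : bounded_op S -> bounded_op T ->
  approximable S -> approximable T -> approximable (fun x => S x + T x).
Proof.
move=> bS bT [u [u0 Iu uF]] [v [v0 Iv vF]].
(* Ranks add up, so each summand may only use rank n/2. *)
exists (fun n => u n./2 + v n./2); split.
- by move=> n; rewrite addr_ge0.
- by apply: (calkinD IP); [exact: (calkin_half IP Iu)|exact: (calkin_half IP Iv)].
move=> n e e0; have e2 : 0 < e / 2 by lra.
have [F [bF rF Fu]] := uF n./2 _ e2; have [G [bG rG Gv]] := vF n./2 _ e2.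
exists (fun x => F x + G x); split; first exact: bounded_opD.
  apply: rank_lt_leq (rank_ltD rF rG).
  by rewrite addnn ltnS -{2}(odd_double_half n) leq_addl.
move=> x dx; rewrite opprD addrACA.
have [[Sd _ _ _] [Td _ _ _]] := (bS, bT); have [[Fd _ _ _] [Gd _ _ _]] := (bF, bG).
apply: le_trans (banach_normD (banach_domB (Sd x dx) (Fd x dx)) (banach_domB (Td x dx) (Gd x dx))) _.
have := Fu x dx; have := Gv x dx; rewrite !mulrDl => le1 le2.
by apply: le_trans (lerD le2 le1) _; lra.
Qed.

Lemma approximableZ a T : bounded_op T -> approximable T -> approximable (fun x => a *: T x).
Proof.
move=> bT [u [u0 Iu uF]]; exists (fun n => cabs a * u n); split.
- by move=> n; rewrite mulr_ge0 ?cabs_ge0.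
- exact: calkinZ.
move=> n e e0; have a1 : 0 < cabs a + 1 by have := cabs_ge0 a; lra.
have [F [bF rF Fu]] := uF n _ (divr_gt0 e0 a1).
exists (fun x => a *: F x); split; [exact: bounded_opZ|exact: rank_ltZ|].
move=> x dx; have [[Td _ _ _] [Fd _ _ _]] := (bT, bF).
rewrite -scalerBr banach_normZ; last exact: banach_domB (Td x dx) (Fd x dx).
apply: le_trans (ler_wpM2l (cabs_ge0 a) (Fu x dx)) _.
rewrite mulrA mulrDr ler_wpM2r//; first by case: bX => _ _ [+ _] _ _; apply.
rewrite lerD2l mulrCA; apply: ler_piMr; first exact: ltW.
by rewrite ler_pdivrMr// mul1r; lra.
Qed.

Lemma bounded_op0 : @bounded_op R X Y (fun=> 0).
Proof.
split=> [x _|x y _ _|a x _|]; [by case: bY => [[]]|by rewrite addr0|by rewrite scaler0|].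
by exists 0 => x _; rewrite (nsnorm0 bY) mul0r.
Qed.

Lemma approximable0 : @approximable X Y (fun=> 0).
Proof.
exists (fun=> 0); split=> //; first exact: calkin0.
move=> n e e0; exists (fun=> 0); split.
- exact: bounded_op0.
- by exists [::]; split=> // x _; exists (fun=> 0); rewrite big_ord0.
- move=> x dx; rewrite subr0 (nsnorm0 bY) add0r; apply: mulr_ge0; first exact: ltW.
  by case: bX => _ _ [+ _] _ _; apply.
Qed.

Lemma bounded_op_ext S T : (forall x, nsdom X x -> S x = T x) ->
  bounded_op S -> bounded_op T.
Proof.
move=> ST [Sd SD SZ [M SM]]; split.
- by move=> x dx; rewrite -ST//; apply: Sd.
- move=> x y dx dy; rewrite -!ST//; first exact: SD.
  by case: bX => [[_ +] _ _ _ _]; apply.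
- move=> a x dx; rewrite -!ST//; first exact: SZ.
  by case: bX => _ + _ _ _; apply.
- by exists M => x dx; rewrite -ST//; apply: SM.
Qed.

Lemma bounded_op_sum (J : Type) (t : seq J) (T : J -> nsV X -> nsV Y) :
  (forall j, bounded_op (T j)) -> bounded_op (fun x => \sum_(j <- t) T j x).
Proof.
move=> bT; elim: t => [|j t IH].
  by apply: bounded_op_ext bounded_op0 => x _; rewrite big_nil.
by apply: bounded_op_ext (bounded_opD (bT j) IH) => x _; rewrite big_cons.
Qed.

Lemma approximable_sum (J : Type) (t : seq J) (T : J -> nsV X -> nsV Y) :
  (forall j, bounded_op (T j)) -> (forall j, approximable (T j)) ->
  approximable (fun x => \sum_(j <- t) T j x).
Proof.
move=> bT aT; elim: t => [|j t IH].
  by apply: approximable_ext approximable0 => x _; rewrite big_nil.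
have bt := bounded_op_sum t bT.
by apply: approximable_ext (approximableD (bT j) bt (aT j) IH) => x _; rewrite big_cons.
Qed.

(** s_n(T) <= s_n(F) + |T - F|, and the first term vanishes when the rank of F is too small. *)
Lemma approximable_sfunction s T : is_sfunction s -> bounded_op T ->
  approximable T -> I (cseq (s X Y T)).
Proof.
move=> [[_ s0] sD _ sr _] bT [u [u0 Iu uF]].
have [_ sge _] := s0 X Y T bX bY bT.
apply: (calkin_le IP Iu) => // n; apply/ler_addgt0Pr => e e0.
have [F [bF rF Fu]] := uF n e e0.
have bG : bounded_op (fun x => T x - F x).
  have -> : (fun x => T x - F x) = (fun x => T x + (-1) *: F x).
    by apply/funext => x; rewrite scaleN1r.
  by apply: bounded_opD => //; apply: bounded_opZ.
have le_n := sD X Y F (fun x => T x - F x) T bX bY bF bG.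
apply: le_trans (le_n _ n) _; first by move=> x _; rewrite addrC subrK.
rewrite sr// add0r; apply: (opnorm_le bX) => //.
by rewrite addr_ge0// ltW.
Qed.

End Approximable.

Lemma approximable_singP (R : realType) (I : set (nat -> R[i])) (H : lmodType R[i])
    (ip : H -> H -> R[i]) (A : H -> H) :
  is_calkin I -> is_hilbert ip -> is_bop ip A ->
  I (cseq (sing ip A)) <-> @approximable R I (hspace ip) (hspace ip) A.
Proof.
move=> IP hP bA; split=> [IA|[u [u0 Iu uF]]].
  exists (sing ip A); split=> // [n|n e e0]; first exact: sing_ge0.
  have : sing ip A n < sing ip A n + e by rewrite ltrDl.
  case/(sing_lt hP) => F [bF rF FA]; exists F; split=> // x _ /=.
  apply: le_trans (bopP hP x (is_bopB hP bA bF)) _.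
  by rewrite ler_wpM2r ?hnorm_ge0// ltW.
apply: (calkin_le IP Iu) => [n|n]; first exact: sing_ge0.
apply/ler_addgt0Pr => e e0; have [F [bF rF Fu]] := uF n e e0.
apply: le_trans (sing_le hP bA bF rF) _; apply: (bop_opn_le hP).
  by rewrite addr_ge0// ltW.
by move=> x; apply: Fu.
Qed.

(** * Dyadic levels and a Schur test *)

Section GeometricSums.
Variable R : realType.
Local Notation h := (2^-1 : R).

Lemma geometric_tail n m : \sum_(q < m | (n <= q)%N) h ^+ q <= 2 * h ^+ n.
Proof.
have h0 k : 0 <= h ^+ k by rewrite exprn_ge0// invr_ge0.
(* The induction has to carry the exact remainder. *)
suff le_m : \sum_(q < m | (n <= q)%N) h ^+ q <= 2 * h ^+ n - 2 * h ^+ (maxn m n).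
  by apply: le_trans le_m _; have := h0 (maxn m n); lra.
elim: m => [|m IH]; first by rewrite big_ord0 max0n subrr.
rewrite big_mkcond big_ord_recr -big_mkcond /=.
have [nm|mn] := leqP n m.
  move: IH; rewrite (maxn_idPl nm) (maxn_idPl (leqW nm)) exprS; lra.
by move: IH; rewrite (maxn_idPr mn) (maxn_idPr (ltnW mn)) addr0.
Qed.

(** By 2ab <= a^2 + b^2 it is enough that every row and every column of the kernel 2^-(p+q),
    restricted to p + q >= N, has sum at most 2 * 2^-N. Bounding all a p and b q by a constant would
    cost a factor of order N. *)
Lemma schur_test N (a b : nat -> R) :
  \sum_(p < N.+1) \sum_(q < N.+1 | (N <= p + q)%N) h ^+ (p + q) * (a p * b q) <=
  h ^+ N * (\sum_(p < N.+1) a p ^+ 2 + \sum_(q < N.+1) b q ^+ 2).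
Proof.
have tail (p : 'I_N.+1) : \sum_(q < N.+1 | (N <= p + q)%N) h ^+ (p + q) <= 2 * h ^+ N.
  under eq_bigr do rewrite exprD; rewrite -mulr_sumr.
  under eq_bigl do rewrite -leq_subLR.
  have := ler_wpM2l (exprn_ge0 p (_ : 0 <= h)) (geometric_tail (N - p)%N N.+1).
  move=> /(_ _)/le_trans; apply; first by rewrite invr_ge0.
  by rewrite mulrCA -exprD subnKC// -ltnS.
apply: (@le_trans _ _ (\sum_(p < N.+1) \sum_(q < N.+1 | (N <= p + q)%N)
    (h ^+ (p + q) * (a p ^+ 2 / 2) + h ^+ (p + q) * (b q ^+ 2 / 2)))).
  apply: ler_sum => p _; apply: ler_sum => q _; rewrite -mulrDr ler_wpM2l//.
    by rewrite exprn_ge0// invr_ge0.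
  by have := sqr_ge0 (a p - b q); rewrite sqrrB -mulr_natl; lra.
under eq_bigr do rewrite big_split -!mulr_suml.
rewrite big_split /= mulrDr; apply: lerD.
  rewrite mulr_sumr; apply: ler_sum => p _.
  by have := ler_wpM2r (sqr_ge0 (a p)) (tail p); lra.
rewrite (exchange_big_dep predT)//= mulr_sumr; apply: ler_sum => q _.
rewrite -mulr_suml; have := tail q; under eq_bigl do rewrite addnC.
under eq_bigr do rewrite addnC.
by move/(ler_wpM2r (sqr_ge0 (b q))); lra.
Qed.

(** The dyadic level of rho relative to c, capped at N: everything below c 2^-N shares the last
    level. *)
Lemma level_exists (rho c : R) N : rho <= c ->
  exists l, [/\ (l <= N)%N, rho <= c * h ^+ l & (l < N)%N -> c * h ^+ l.+1 < rho].
Proof.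
move=> rc; elim: N => [|N [l [lN rl lr]]]; first by exists 0%N; split=> //; rewrite expr0 mulr1.
move: lN; rewrite leq_eqVlt => /orP[/eqP lN|lN]; last first.
  by exists l; split=> [||_]; [exact: leqW (ltnW lN)|by []|exact: lr].
have [rl'|lr'] := leP rho (c * h ^+ N.+1); first by exists N.+1; split=> //; rewrite ltnn.
by exists N; split=> //; rewrite -lN.
Qed.

(** N is the first exponent with c 2^-N <= 4 mu; minimality gives the lower bound 2 mu, so that one
    further halving is still at least mu. N = 0 is the first alternative, where the operator is
    small enough to be approximated by 0. *)
Lemma halving_index (c mu : R) : 0 <= c -> 0 < mu ->
  c <= 4 * mu \/ exists2 N, 2 * mu <= c * h ^+ N & c * h ^+ N <= 4 * mu.
Proof.
move=> c0 mu0.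
have exN : exists N, c * h ^+ N <= 4 * mu.
  exists (Num.Def.archi_bound (c / (4 * mu))); set n := Num.Def.archi_bound _.
  have : c / (4 * mu) <= 2 ^+ n.
    apply: le_trans (ltW (archi_boundP _)) _; first by rewrite divr_ge0//; lra.
    by rewrite -natrX ler_nat ltnW// ltn_expl.
  rewrite ler_pdivrMr; last by lra.
  by rewrite exprVn ler_pdivrMr ?exprn_gt0// mulrC.
have [N cN minN] := ex_minnP exN; case: N cN minN => [|N] cN minN.
  by left; move: cN; rewrite expr0 mulr1.
right; exists N.+1 => //; have : ~~ (c * h ^+ N <= 4 * mu).
  by apply/negP => /minN; rewrite ltnn.
by rewrite -ltNge exprS; lra.
Qed.

End GeometricSums.

(** * Block decomposition of A X B *)

Section MultiplicationOperators.
Variables (R : realType) (H : lmodType R[i]) (ip : H -> H -> R[i]).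
Hypothesis hP : is_hilbert ip.
Local Notation N := (hnorm ip).
Local Notation hs := (hspace ip).
Local Notation opn := (@opnorm R hs hs).
Local Notation h := (2^-1 : R).
Let ipP := hilbert_inner hP.

(** Each e_i gets the level of rho i. The block p < n is the projection on the vectors of level p;
    the block n collects the rest, including what is orthogonal to all of [e]. *)
Lemma level_blocks T (e : nat -> H) (rho : nat -> R) (c : R) n :
  orthosystem ip e -> 0 <= c -> (forall k, rho k <= c) ->
  (forall d : R, 0 < d -> exists K, forall k, (K <= k)%N -> rho k < d) ->
  (forall k x, (forall i, (i < k)%N -> ip x (e i) = 0) -> N (T x) <= rho k * N x) ->
  exists (lev : nat -> nat) K,
  (forall k, (lev k <= n)%N) /\
  (forall k, (lev k < n)%N -> (k < K)%N /\ c * h ^+ (lev k).+1 < rho k) /\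
  forall x, exists b : nat -> H,
    [/\ forall p, (p < n)%N -> b p = oproj ip e K (fun i => lev i == p) x,
        x = \sum_(p < n.+1) b p,
        \sum_(p < n.+1) N (b p) ^+ 2 = N x ^+ 2 &
        forall p, (p <= n)%N -> N (T (b p)) <= c * h ^+ p * N (b p)].
Proof.
move=> eo c0 rc rho0 eT.
have /choice[lev levP] := fun k => level_exists n (rc k).
have h0 k : 0 <= h ^+ k by rewrite exprn_ge0// invr_ge0.
have lt_rho k : (lev k < n)%N -> c * h ^+ n < rho k.
  move=> lk; have [_ _ /(_ lk)] := levP k; apply: le_lt_trans.
  rewrite ler_wpM2l// -(subnKC lk) exprD ler_piMr// exprn_ile1 ?invr_ge0//.
  by rewrite invf_le1 ?ler1n.
(* Only finitely many rho k exceed c 2^-n, as rho tends to 0; if c = 0, no index has level below n,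
   because that would force rho k > 0. *)
have [K KP] : exists K, forall k, (lev k < n)%N -> (k < K)%N.
  have [c1|c1] := eqVneq c 0.
    by exists 0%N => k /lt_rho; rewrite c1 mul0r => rk; have := rc k; rewrite c1 leNgt rk.
  have cn : 0 < c * h ^+ n by rewrite mulr_gt0 ?exprn_gt0 ?invr_gt0// lt_neqAle eq_sym c1.
  have [K KP] := rho0 _ cn; exists K => k /lt_rho; apply: contraTT; rewrite -leqNgt.
  by move/KP; rewrite -leNgt => /ltW.
exists lev, K; split; first by move=> k; have [] := levP k.
split=> [k lk|x]; first by split; [exact: KP|have [_ _] := levP k; apply].
pose b p := if (p < n)%N then oproj ip e K (fun i => lev i == p) x
            else x - oproj ip e K (fun i => (lev i < n)%N) x.
have bE p : (p < n)%N -> b p = oproj ip e K (fun i => lev i == p) x by rewrite /b => ->.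
have bn : b n = x - oproj ip e K (fun i => (lev i < n)%N) x by rewrite /b ltnn.
have bn_e i : (lev i < n)%N -> ip (b n) (e i) = 0.
  by move=> li; rewrite bn ipBl// ip_oproj// KP// li subrr.
have sumb : x = \sum_(p < n.+1) b p.
  rewrite big_ord_recr /= bn.
  suff -> : \sum_(p < n) b p = oproj ip e K (fun i => (lev i < n)%N) x.
    by rewrite addrC subrK.
  under eq_bigr do rewrite bE//; rewrite /oproj.
  rewrite (exchange_big_dep (fun i : 'I_K => (lev i < n)%N)) /=; last first.
    by move=> p i _ /eqP ->.
  by apply: eq_bigr => i li; rewrite (big_pred1 (Ordinal li)).
have bo (p q : 'I_n.+1) : (p < q)%N -> ip (b p) (b q) = 0.
  move=> pq; have pn : (p < n)%N by rewrite (leq_trans pq)// -ltnS.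
  have := ltn_ord q; rewrite ltnS leq_eqVlt => /orP[/eqP qn|qn].
    rewrite qn (ipC ipP) (bE p)// ip_oproj_r// big1 ?conjc0// => i /eqP li.
    by rewrite bn_e ?mulr0// li.
  rewrite (bE p)// (bE q)// oproj_ortho// => i _ /eqP ->; apply: contraTN pq => /eqP ->.
  by rewrite ltnn.
exists b; split=> //.
  rewrite [in RHS]sumb hnorm_sqr_sum_ord// => p q; rewrite neq_ltn => /orP[/bo//|/bo qp].
  by rewrite (ipC ipP) qp conjc0.
move=> p pn.
(* For the first index m of level at least p, the block p is orthogonal to all e_i with i < m, so T
   is bounded on it by rho m <= c 2^-p. Taking the first such m replaces monotonicity of rho. *)
have exm : exists m, (p <= lev m)%N.
  by exists K; apply: leq_trans pn _; rewrite leqNgt; apply/negP => /KP; rewrite ltnn.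
have [m pm minm] := ex_minnP exm.
apply: le_trans (eT m _ _) _.
  move=> i im; have li : (lev i < p)%N.
    by rewrite ltnNge; apply/negP => /minm; rewrite leqNgt im.
  move: pn; rewrite leq_eqVlt => /orP[/eqP pn|pn]; first by rewrite pn bn_e// -pn.
  by rewrite bE// ip_oproj// (ltn_eqF li) andbF.
apply: ler_wpM2r; first exact: hnorm_ge0.
have [_ /le_trans + _] := levP m; apply.
rewrite ler_wpM2l// -(subnKC pm) exprD ler_piMr// exprn_ile1 ?invr_ge0//.
by rewrite invf_le1 ?ler1n.
Qed.

(** Converts the sum of squares left by the Schur test into an operator bound: z is the multiple of
    y with |z| = |w|. *)
Lemma hnorm_le_polarized y w (K : R) : 0 <= K -> (w = 0 -> y = 0) ->
  (forall z, cabs (ip y z) <= K * (N w ^+ 2 + N z ^+ 2)) -> N y <= 2 * K * N w.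
Proof.
move=> K0 w0 yz.
have [->|y0] := eqVneq y 0; first by rewrite hnorm0// !mulr_ge0 ?hnorm_ge0.
have wp : 0 < N w by apply: (hnorm_gt0 ipP); apply: contra_neq y0.
have yp := hnorm_gt0 ipP y0.
have := yz (((N w / N y)%:C)%C *: y).
have wy : 0 <= N w / N y by rewrite divr_ge0 ?hnorm_ge0.
rewrite ipZr// conjc_real ipxx// cabsM !cabs_real ger0_norm// ger0_norm ?sqr_ge0//.
rewrite hnormZ// cabs_real ger0_norm// divfK ?gt_eqF// expr2 mulrA divfK ?gt_eqF//.
rewrite (_ : K * _ = N w * (2 * K * N w)); last by ring.
by rewrite ler_pM2l.
Qed.

Section TwoSided.
Variables (A A' B : H -> H) (e f : nat -> H) (rho tau : nat -> R) (c d : R).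
Hypotheses (bA : is_bop ip A) (bB : is_bop ip B) (bA' : is_bop ip A').
Hypothesis AA' : forall x y, ip (A x) y = ip x (A' y).
Hypotheses (eo : orthosystem ip e) (fo : orthosystem ip f).
Hypotheses (c0 : 0 <= c) (d0 : 0 <= d).
Hypotheses (rc : forall k, rho k <= c) (td : forall k, tau k <= d).
Hypothesis rho0 : forall t : R, 0 < t -> exists K, forall k, (K <= k)%N -> rho k < t.
Hypothesis tau0 : forall t : R, 0 < t -> exists K, forall k, (K <= k)%N -> tau k < t.
Hypothesis eA : forall k x, (forall i, (i < k)%N -> ip x (e i) = 0) -> N (A' x) <= rho k * N x.
Hypothesis fB : forall k x, (forall i, (i < k)%N -> ip x (f i) = 0) -> N (B x) <= tau k * N x.

(** The approximant keeps the blocks of A X B with p + q < n. E is fixed before X, so the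
    approximant is one linear map of X whose rank is at most the size of E. *)
Lemma two_sided_approx n (S : seq (nat * nat)) :
  (forall i j, (i, j) \notin S -> rho i * tau j <= c * d * h ^+ n.+1) ->
  exists2 E : seq (nat * nat), (size E <= size S)%N &
  forall X, is_bop ip X -> forall w,
   N (A (X (B w)) -
      (\sum_(x <- E) ip (A (X (B (f x.2)))) (e x.1) *: rank1 ip (e x.1) (f x.2)) w)
   <= 2 * (c * d * h ^+ n * opn X) * N w.
Proof.
move=> SP; have h0 k : 0 <= h ^+ k by rewrite exprn_ge0// invr_ge0.
have [lev [K [levn [levP blkA]]]] := level_blocks n eo c0 rc rho0 eA.
have [lew [L [lewn [lewP blkB]]]] := level_blocks n fo d0 td tau0 fB.
pose P (x : 'I_K * 'I_L) := (lev x.1 + lew x.2 < n)%N.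
pose E := [seq (val x.1, val x.2) | x : 'I_K * 'I_L <- enum P].
exists E.
  apply: uniq_leq_size.
    by rewrite map_inj_uniq ?enum_uniq// => -[i j] [i' j'] [/val_inj -> /val_inj ->].
  (* Levels with sum below n give rho i * tau j > c d 2^-(lev i + lew j + 2) >= c d 2^-(n+1), so the
     pair belongs to S; hence the exponent n + 1 in the hypothesis. *)
  move=> _ /mapP[[i j] + ->] /=; rewrite mem_enum unfold_in /P /= => ij.
  apply: contraT => /SP; rewrite leNgt => /negP; case.
  have [_ li] := levP i (leq_ltn_trans (leq_addr _ _) ij).
  have [_ lj] := lewP j (leq_ltn_trans (leq_addl _ _) ij).
  apply: le_lt_trans (ltr_pM _ _ li lj); rewrite ?mulr_ge0//.
  rewrite mulrACA ler_wpM2l ?mulr_ge0// -exprD addSn addnS.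
  rewrite -(subnKC (_ : ((lev i + lew j).+2 <= n.+1)%N))// exprD ler_piMr//.
  by rewrite exprn_ile1 ?invr_ge0// invf_le1 ?ler1n.
move=> X bX w; set y := A (X (B w)) - _.
have cdX : 0 <= c * d * h ^+ n * opn X by rewrite !mulr_ge0// (bop_opn_ge0 hP).
have FE v : (\sum_(x <- E) ip (A (X (B (f x.2)))) (e x.1) *: rank1 ip (e x.1) (f x.2)) v =
    \sum_(x : 'I_K * 'I_L | P x) (ip (A (X (B (f x.2)))) (e x.1) * ip v (f x.2)) *: e x.1.
  rewrite fct_sumE /E big_map big_enum; apply: eq_bigr => x _ /=.
  by rewrite /rank1 !fctE scalerA.
apply: hnorm_le_polarized => // [w0|z].
  rewrite /y FE w0 (bop0 bB) (bop0 bX) (bop0 bA) big1 ?subr0// => x _.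
  by rewrite ip0l// mulr0 scale0r.
have [zb [zE zS zN zA]] := blkA z; have [wb [wE wS wN wB]] := blkB w.
have yE : ip y z = \sum_(p < n.+1) \sum_(q < n.+1 | (n <= p + q)%N) ip (X (B (wb q))) (A' (zb p)).
  rewrite /y ipBl//.
  have -> : ip (A (X (B w))) z =
      \sum_(p < n.+1) \sum_(q < n.+1) ip (X (B (wb q))) (A' (zb p)).
    rewrite AA' [in A' z]zS (bop_sum bA') (ip_sumr ipP); apply: eq_bigr => p _.
    by rewrite [in LHS]wS (bop_sum bB) (bop_sum bX) (ip_suml ipP).
  rewrite FE (ip_suml ipP).
  (* Sorted by pairs of levels, the approximant becomes the sum of the blocks with p + q < n, which
     cancel. *)
  pose phi (x : 'I_K * 'I_L) : 'I_n.+1 * 'I_n.+1 := (inord (lev x.1), inord (lew x.2)).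
  rewrite (partition_big phi (fun pq => (pq.1 + pq.2 < n)%N)) /=; last first.
    by move=> x Px; rewrite !inordK// ltnS.
  rewrite [X in _ - X](_ : _ = \sum_(p < n.+1) \sum_(q < n.+1 | (p + q < n)%N)
    \sum_(x | P x && (phi x == (p, q)))
      ip ((ip (A (X (B (f x.2)))) (e x.1) * ip w (f x.2)) *: e x.1) z); last first.
    by rewrite [RHS]pair_big_dep; apply: eq_big => [[p q]|[p q] _].
  rewrite -sumrB; apply: eq_bigr => p _.
  rewrite (bigID (fun q : 'I_n.+1 => (p + q < n)%N)) /= addrC.
  under [X in X + _ - _]eq_bigl do rewrite -leqNgt.
  rewrite -addrA -sumrB [X in _ + X]big1 ?addr0// => q pq; apply/eqP; rewrite subr_eq0; apply/eqP.
  have pn := leq_ltn_trans (leq_addr q p) pq; have qn := leq_ltn_trans (leq_addl p q) pq.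
  rewrite -AA' zE// wE// ip_oproj_r//.
  transitivity (\sum_(i < K | lev i == p) \sum_(j < L | lew j == q)
     ip ((ip (A (X (B (f j)))) (e i) * ip w (f j)) *: e i) z).
    apply: eq_bigr => i _; rewrite /oproj (bop_sum bB) (bop_sum bX) (bop_sum bA) (ip_suml ipP) mulr_sumr.
    apply: eq_bigr => j _; rewrite (bopZ bB) (bopZ bX) (bopZ bA) !(ipZl ipP) (ipC ipP z) /=; ring.
  rewrite (pair_big (fun i : 'I_K => lev i == p) (fun j : 'I_L => lew j == q) (fun i j =>
     ip ((ip (A (X (B (f j)))) (e i) * ip w (f j)) *: e i) z)) /=.
  apply: eq_bigl => -[i j] /=; rewrite /P /phi /= xpair_eqE.
  rewrite -!val_eqE /= !inordK ?ltnS//.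
  by case: eqP => [->|_]; case: eqP => [->|_]; rewrite ?pq ?andbF.
rewrite yE; apply: le_trans (ler_cabs_sum _ _ _) _.
apply: (@le_trans _ _ (c * d * opn X *
  \sum_(p < n.+1) \sum_(q < n.+1 | (n <= p + q)%N) h ^+ (p + q) * (N (zb p) * N (wb q)))).
  rewrite mulr_sumr; apply: ler_sum => p _.
  apply: le_trans (ler_cabs_sum _ _ _) _; rewrite mulr_sumr; apply: ler_sum => q _.
  apply: le_trans (cauchy_schwarz ipP _ _) _.
  apply: (@le_trans _ _ (opn X * (d * h ^+ q * N (wb q)) * (c * h ^+ p * N (zb p)))).
    apply: ler_pM; rewrite ?hnorm_ge0//; last by apply: zA; rewrite -ltnS.
    apply: le_trans (bopP hP _ bX) _; rewrite ler_wpM2l ?(bop_opn_ge0 hP)//.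
    by apply: wB; rewrite -ltnS.
  by rewrite exprD le_eqVlt; apply/orP; left; apply/eqP; ring.
apply: le_trans (ler_wpM2l _ (schur_test n (fun p => N (zb p)) (fun q => N (wb q)))) _.
  by rewrite !mulr_ge0// (bop_opn_ge0 hP).
by rewrite zN wN le_eqVlt; apply/orP; left; apply/eqP; ring.
Qed.

End TwoSided.

End MultiplicationOperators.

(** A matrix of maximal rank with rows in V has V as its row space; if this is not everything, the
    kernel of the transpose supplies the annihilating vector. *)
Lemma subspace_full_or_annihilated (F : fieldType) m (V : 'rV[F]_m -> Prop) :
  V 0 -> (forall a x y, V x -> V y -> V (a *: x + y)) ->
  (forall v, V v) \/ exists2 d : 'rV[F]_m, d != 0 &
    forall v, V v -> \sum_i d 0 i * v 0 i = 0.
Proof.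
move=> V0 VD.
have Vspan k (M : 'M_(k, m)) (x : 'rV_k) : (forall i, V (row i M)) -> V (x *m M).
  by move=> VM; rewrite mulmx_sum_row; elim/big_rec: _ => // i y _ Vy; apply: VD.
pose P r := `[< exists M : 'M[F]_m, (forall i, V (row i M)) /\ \rank M = r >].
have exP : exists r, P r.
  by exists 0%N; apply/asboolP; exists 0; rewrite mxrank0; split=> // i; rewrite row0.
have ubP r : P r -> (r <= m)%N by move=> /asboolP[M [_ <-]]; apply: rank_leq_row.
have [r /asboolP[M [VM rM]] maxr] := ex_maxnP exP ubP.
have sub v : V v -> (v <= M)%MS.
  move=> Vv; have : P (\rank (M + v)%MS).
    apply/asboolP; exists (M + v)%MS; split=> // i.
    have /sub_addsmxP[[x y] /= ->] : (row i (M + v)%MS <= M + v)%MS by apply: row_sub.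
    rewrite -[_ + _]scale1r scalerDr addrC; apply: VD; last first.
      by rewrite scale1r; apply: Vspan.
    by apply: Vspan => j; rewrite row_id.
  move/maxr; rewrite -rM => le_r.
  apply: submx_trans (addsmxSr M v) _.
  by rewrite -(geq_leqif (mxrank_leqif_sup (addsmxSl M v))).
have [full|nfull] := boolP (row_full M).
  by left=> v; have /submxP[x ->] := submx_full v full; apply: Vspan.
right; have : kermx M^T != 0.
  by rewrite kermx_eq0 /row_free mxrank_tr.
case/rowV0Pn => d /sub_kermxP dM d0; exists d => // v /sub/submxP[x ->].
have : d *m (x *m M)^T = 0 by rewrite trmx_mul mulmxA dM mul0mx.
by move/matrixP/(_ 0 0); rewrite !mxE; under eq_bigr do rewrite mxE.
Qed.

(** * Upper bound for M_{A,B} and factorisation through an elementary operator *)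

Section OperatorSpaces.
Variables (R : realType) (H : lmodType R[i]) (ip : H -> H -> R[i]).
Hypothesis hP : is_hilbert ip.
Local Notation N := (hnorm ip).
Local Notation hs := (hspace ip).
Local Notation opn := (@opnorm R hs hs).
Let ipP := hilbert_inner hP.

Definition DH (D : set (H -> H)) : nspace R :=
  NSpace ((H -> H) : lmodType R[i]) D opn.

(* The two cases B(H) = DH (is_bop ip) and K(H) = DH (is_compact_op ip) are
   treated at once. *)
Definition operator_space (D : set (H -> H)) : Prop :=
  [/\ is_banach (DH D), D `<=` is_bop ip, forall y h, D (rank1 ip y h) &
      forall A X B, is_bop ip A -> D X -> is_bop ip B -> D (A \o X \o B)].

Lemma bounded_operators_space : operator_space (is_bop ip).
Proof.
split=> // [||A X B bA bX bB]; [exact: BH_banach|exact: is_bop_rank1|].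
by apply: is_bop_comp => //; apply: is_bop_comp.
Qed.

Lemma compact_operators_space : operator_space (is_compact_op ip).
Proof.
split=> [|X []//||A X B bA bX bB]; [exact: KH_banach|exact: compact_rank1|].
by apply: compact_compr => //; apply: compact_compl.
Qed.

Lemma parseval m (y : 'I_m -> H) (a : 'I_m -> R[i]) :
  (forall i j, ip (y i) (y j) = (i == j)%:R) ->
  N (\sum_i a i *: y i) ^+ 2 = \sum_i cabs (a i) ^+ 2.
Proof.
move=> yo; rewrite (hnorm_sqr_sum_ord ipP) => [|i j ij].
  by apply: eq_bigr => i _; rewrite (hnormZ ipP) exprMn (hnorm_sqr ipP) yo eqxx mulr1.
by rewrite (ipZl ipP) (ipZr ipP) yo (negPf ij) !mulr0.
Qed.

Lemma bessel m (y : 'I_m -> H) x : (forall i j, ip (y i) (y j) = (i == j)%:R) ->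
  \sum_i cabs (ip x (y i)) ^+ 2 <= N x ^+ 2.
Proof.
move=> yo; have := sqr_ge0 (N (x - \sum_i ip x (y i) *: y i)).
rewrite (hnorm_sqrB ipP) parseval// (ip_sumr ipP) Re_sum.
have -> : \sum_i Re (ip x (ip x (y i) *: y i)) = \sum_i cabs (ip x (y i)) ^+ 2.
  by apply: eq_bigr => i _; rewrite (ipZr ipP) mulrC mul_conjc.
by lra.
Qed.

Variable D : set (H -> H).
Hypothesis DP : operator_space D.

Lemma DH_banach : is_banach (DH D).
Proof. by case: DP. Qed.

Lemma D_bop X : D X -> is_bop ip X.
Proof. by case: DP => _ + _ _; apply. Qed.

Lemma D_rank1 y h : D (rank1 ip y h).
Proof. by case: DP. Qed.

Lemma D_sum (J : Type) (t : seq J) (P : pred J) (f : J -> H -> H) :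
  (forall j, D (f j)) -> D (\sum_(j <- t | P j) f j).
Proof.
move=> Df; case: DH_banach => [[D0 DD] _ _ _ _]; elim/big_ind: _ => //; exact: DD.
Qed.

Lemma D_Z (a : R[i]) X : D X -> D (a *: X).
Proof. by case: DH_banach => _ + _ _ _; apply. Qed.

Lemma Mop_bounded A B : is_bop ip A -> is_bop ip B ->
  @bounded_op R (DH D) (DH D) (Mop A B).
Proof.
move=> bA bB; split.
- by move=> X DX; case: DP => _ _ _; apply.
- by move=> X Y DX DY; apply/funext => x; rewrite /Mop /= (bopD bA).
- by move=> a X DX; apply/funext => x; rewrite /Mop /= (bopZ bA).
- exists (opn A * opn B) => X DX /=; have bX := D_bop DX.
  have [A0 B0 X0] := And3 (bop_opn_ge0 hP bA) (bop_opn_ge0 hP bB) (bop_opn_ge0 hP bX).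
  apply: (bop_opn_le hP); first by rewrite !mulr_ge0.
  move=> x; rewrite /Mop /=; apply: le_trans (bopP hP _ bA) _.
  rewrite -!mulrA ler_wpM2l// (le_trans (bopP hP _ bX))// mulrCA ler_wpM2l//.
  exact: bopP.
Qed.

Lemma elem_rep_bounded m (A B : 'I_m -> H -> H) Phi : elem_rep ip D Phi A B ->
  @bounded_op R (DH D) (DH D) Phi.
Proof.
move=> [bAB PhiE].
apply: (@bounded_op_ext R (DH D) (DH D) DH_banach (fun X => \sum_(j < m) Mop (A j) (B j) X)).
  by move=> X DX; rewrite PhiE.
apply: (bounded_op_sum DH_banach DH_banach) => j.
by have [bA bB] := bAB j; apply: Mop_bounded.
Qed.

Lemma Mop_approximable (I : set (nat -> R[i])) A B :
  is_calkin I -> stable I -> is_bop ip A -> is_bop ip B ->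
  I (cseq (sing ip A)) -> I (cseq (sing ip B)) ->
  @approximable R I (DH D) (DH D) (Mop A B).
Proof.
move=> IP sI bA bB IA IB; have [A' bA' AA'] := adjoint hP bA.
have [e eo eA] := orthosystem_approx_adjoint hP bA bA' AA'.
have [f fo fB] := orthosystem_approx hP bB.
pose rho k := 4 * sing ip A k./2; pose tau k := 4 * sing ip B k./2.
have rho0 k : 0 <= rho k by rewrite mulr_ge0// sing_ge0.
have tau0 k : 0 <= tau k by rewrite mulr_ge0// sing_ge0.
have Irho : I (cseq rho) := calkinZ IP 4 (calkin_half IP IA).
have Itau : I (cseq tau) := calkinZ IP 4 (calkin_half IP IB).
have cvg u : (forall k, 0 <= u k) -> I (cseq u) ->
    forall t : R, 0 < t -> exists K, forall k, (K <= k)%N -> u k < t.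
  move=> u0 /(calkin_c0 IP) cu t /cu[K Kt]; exists K => k /Kt.
  by rewrite cabs_real ger0_norm.
pose c := rho 0%N; pose d := tau 0%N.
have rc k : rho k <= c by rewrite /rho ler_wpM2l// (sing_mono hP).
have td k : tau k <= d by rewrite /tau ler_wpM2l// (sing_mono hP).
pose gam n := complex.Re (tens (cseq rho) (cseq tau) n).
have gam0 n : 0 <= gam n := tens_Re_ge0 _ _ _.
(* The 8 is the factor 2 of [two_sided_approx] times the 4 of [halving_index]. *)
exists (fun n => 8 * gam n); split.
- by move=> n; rewrite mulr_ge0.
- exact/(calkinZ IP)/(stable_tens sI Irho Itau).
(* The infimum defining the tensor product yields a set of pairs only for thresholds strictly above
   it. *)
move=> n t t0; pose mu := gam n + t / 8.
have gmu : gam n < mu by rewrite /mu; lra.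
have mu0 : 0 < mu := le_lt_trans (gam0 n) gmu.
have muE : 8 * gam n + t = 8 * mu by rewrite /mu; lra.
have [S Sn SP] := tens_lt IP rho0 tau0 Irho Itau gmu.
have [c0 d0] : 0 <= c /\ 0 <= d by split; [exact: rho0|exact: tau0].
have cd0 : 0 <= c * d := mulr_ge0 c0 d0.
have [cd|[k mucd cdmu]] := halving_index cd0 mu0.
  (* Here |A X B| <= c d |X| is already small enough, so 0 is the approximant. *)
  exists (fun=> 0); split; first exact: (@bounded_op0 R (DH D) (DH D) DH_banach).
    by exists [::]; split=> // X _; exists (fun=> 0); rewrite big_ord0.
  move=> X DX; rewrite subr0 /= muE; have bX := D_bop DX.
  have X0 := bop_opn_ge0 hP bX.
  apply: (bop_opn_le hP) => [|w]; first by rewrite !mulr_ge0// ltW.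
  rewrite /Mop /=; apply: (@le_trans _ _ (c * d * opn X * N w)); last first.
    by rewrite ler_wpM2r ?hnorm_ge0// ler_wpM2r//; lra.
  apply: (hnorm_le_dual ipP); first exact: mulr_ge0 (mulr_ge0 cd0 X0) (hnorm_ge0 ip w).
  move=> z; rewrite AA'; apply: le_trans (cauchy_schwarz ipP _ _) _.
  apply: (@le_trans _ _ ((opn X * (d * N w)) * (c * N z))).
    apply: ler_pM; rewrite ?hnorm_ge0//; last exact: (eA 0%N).
    apply: le_trans (bopP hP _ bX) _; rewrite ler_wpM2l//; exact: (fB 0%N).
  by rewrite le_eqVlt; apply/orP; left; apply/eqP; ring.
have [|E ES EP] := two_sided_approx hP bA bB bA' AA' eo fo (rho0 0%N) (tau0 0%N) rc td
    (cvg _ rho0 Irho) (cvg _ tau0 Itau) eA fB (n := k) (S := S).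
  by move=> i j /SP/ltW/le_trans; apply; rewrite exprS; move: mucd; rewrite /c /d; lra.
pose F X : H -> H :=
  \sum_(x <- E) ip (A (X (B (f x.2)))) (e x.1) *: rank1 ip (e x.1) (f x.2).
have DF X : D (F X) by apply: D_sum => x; apply/D_Z/D_rank1.
have appr X : D X -> opn (Mop A B X - F X) <= 8 * mu * opn X.
  move=> DX; have bX := D_bop DX; have X0 := bop_opn_ge0 hP bX.
  apply: (bop_opn_le hP) => [|w]; first by rewrite !mulr_ge0// ltW.
  apply: le_trans (EP X bX w) _; rewrite ler_wpM2r ?hnorm_ge0// mulrA ler_wpM2r//.
  by move: cdmu; rewrite /c /d; lra.
exists F; split; last by move=> X DX; rewrite muE; exact: appr.
  (* Boundedness of F follows from that of M_{A,B} and of the difference just estimated. *)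
  have [M M0 MP] := bounded_op_cst DH_banach (Mop_bounded bA bB).
  split=> [X _|X Y DX DY|a X DX|]; first exact: DF.
  - rewrite /F -big_split; apply: eq_bigr => x _ /=.
    by rewrite -scalerDl -(ipDl ipP) -(bopD bA).
  - rewrite /F scaler_sumr; apply: eq_bigr => x _ /=.
    by rewrite scalerA -(ipZl ipP) -(bopZ bA).
  - exists (M + 8 * mu) => X DX /=; rewrite mulrDl.
    have [_ _ nZ nD] := BH_banach_norm hP.
    have bM : is_bop ip (Mop A B X).
      by apply: D_bop; case: DP => _ _ _; apply.
    have -> : F X = Mop A B X - (Mop A B X - F X) by rewrite opprB addrC subrK.
    have bMF := is_bopB hP bM (D_bop (DF X)).
    apply: le_trans (nD _ _ bM (is_bopN hP bMF)) _.
    rewrite -scaleN1r nZ// cabsN cabs1 mul1r.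
    by apply: lerD; [exact: MP|exact: appr].
exists [seq rank1 ip (e x.1) (f x.2) | x <- E]; rewrite size_map; split.
  by rewrite ltnS (leq_trans ES).
move=> X DX; exists (fun i => ip (A (X (B (f (nth (0, 0) E i).2)))) (e (nth (0, 0) E i).1)).
rewrite /F (big_nth (0%N, 0%N)) big_mkord; apply: eq_bigr => i _.
by rewrite (nth_map (0%N, 0%N)).
Qed.

(** The identity of l_2^(n+1) is S Phi T, and its last s-number is 1. *)
Lemma sfunction_ge s Phi n (T : 'rV[R[i]]_n.+1 -> H -> H)
    (S : (H -> H) -> 'rV[R[i]]_n.+1) (k1 k2 : R) :
  is_sfunction s -> @bounded_op R (DH D) (DH D) Phi -> 0 <= k1 -> 0 <= k2 ->
  (forall a, D (T a)) -> (forall a b, T (a + b) = T a + T b) ->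
  (forall c a, T (c *: a) = c *: T a) ->
  (forall a, opn (T a) <= k1 * hnorm (@rv_ip R n.+1) a) ->
  (forall X Y, S (X + Y) = S X + S Y) -> (forall c X, S (c *: X) = c *: S X) ->
  (forall X, D X -> hnorm (@rv_ip R n.+1) (S X) <= k2 * opn X) ->
  (forall a, S (Phi (T a)) = a) ->
  1 <= k2 * k1 * s (DH D) (DH D) Phi n.
Proof.
move=> [[_ s0] _ sM _ sI] bPhi k10 k20 TD TA TZ Tk SA SZ Sk SPT.
have bl := l2n_banach R n.+1; have bD := DH_banach.
have bT : @bounded_op R (l2n R n.+1) (DH D) T.
  split=> [a _|a b _ _|c a _|]; [exact: TD|exact: TA|exact: TZ|].
  by exists k1 => a _; rewrite l2n_norm; exact: Tk.
have bS : @bounded_op R (DH D) (l2n R n.+1) S.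
  split=> [X _|X Y _ _|c X _|]; [by []|exact: SA|exact: SZ|].
  by exists k2 => X DX; rewrite l2n_norm; exact: Sk.
have [_ sge _] := s0 _ _ _ bD bD bPhi.
have := sM (l2n R n.+1) (DH D) (DH D) (l2n R n.+1) T Phi S id bl bD bD bl bT bPhi bS (fun a _ => esym (SPT a)) n.
rewrite sI => /le_trans; apply; apply: ler_wpM2r => //.
apply: ler_pM; try exact: opnorm_ge0.
  by apply: (opnorm_le bD) => // X DX; rewrite l2n_norm; exact: Sk.
by apply: (opnorm_le bl) => // a _; rewrite l2n_norm; exact: Tk.
Qed.

End OperatorSpaces.

Lemma real_complex1 (R : realType) : ((1 : R)%:C)%C = 1.
Proof. by []. Qed.

(** * Lower bound: singular numbers controlled by the s-numbers of Phi *)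

Section LowerBound.
Variables (R : realType) (H : lmodType R[i]) (ip : H -> H -> R[i]).
Hypothesis hP : is_hilbert ip.
Local Notation N := (hnorm ip).
Local Notation hs := (hspace ip).
Local Notation opn := (@opnorm R hs hs).
Let ipP := hilbert_inner hP.

Lemma rv_hnorm_sqr m (a : 'rV[R[i]]_m) :
  hnorm (@rv_ip R m) a ^+ 2 = \sum_j cabs (a 0 j) ^+ 2.
Proof.
by rewrite -l2n_norm /= sqr_sqrtr// sumr_ge0// => j _; exact: sqr_ge0.
Qed.

Lemma rv_hnorm_row_le m (v : 'I_m -> R[i]) (t : 'I_m -> R) (M nu : R) :
  0 < nu -> 0 <= M -> (forall l, nu <= t l) -> \sum_l cabs (v l) ^+ 2 <= M ^+ 2 ->
  hnorm (@rv_ip R m) (\row_l (v l * ((t l)^-1%:C)%C)) <= M / nu.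
Proof.
move=> nu0 M0 nut vM.
have t0 l : 0 < t l := lt_le_trans nu0 (nut l).
rewrite -(ler_pXn2r (n := 2)) ?nnegrE ?hnorm_ge0 ?divr_ge0 ?(ltW nu0)//.
rewrite rv_hnorm_sqr exprMn; apply: (@le_trans _ _ ((\sum_l cabs (v l) ^+ 2) * nu^-1 ^+ 2)).
  rewrite mulr_suml; apply: ler_sum => l _; rewrite mxE cabsM cabs_real exprMn.
  rewrite ler_wpM2l ?sqr_ge0// ger0_norm ?invr_ge0 ?(ltW (t0 l))//.
  by rewrite ler_pXn2r ?nnegrE ?invr_ge0 ?(ltW (t0 l)) ?(ltW nu0)// lef_pV2 ?posrE.
by rewrite ler_wpM2r ?sqr_ge0.
Qed.

Variables (D : set (H -> H)) (I : set (nat -> R[i])).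
Variable s : forall X Y : nspace R, (nsV X -> nsV Y) -> nat -> R.
Arguments s : clear implicits.
Hypotheses (DP : operator_space ip D) (IP : is_calkin I) (sP : is_sfunction s).
Variables (Phi : (H -> H) -> H -> H) (m : nat) (A B : 'I_m -> H -> H).
Hypothesis rep : elem_rep ip D Phi A B.
Hypothesis IPhi : I (cseq (s (DH ip D) (DH ip D) Phi)).

Let bA i : is_bop ip (A i) := (rep.1 i).1.
Let bB i : is_bop ip (B i) := (rep.1 i).2.
Let bPhi := elem_rep_bounded hP DP rep.

Lemma PhiE X w : D X -> Phi X w = \sum_(i < m) A i (X (B i w)).
Proof. by move=> DX; rewrite rep.2// fct_sumE. Qed.

(** For the vectors of [sing_ortho_vectors] one may take nu = a_2k / 4, which turns the hypothesis
    into a_2k <= 4 K s_k(Phi); monotonicity covers the odd indices. *)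
Lemma sing_class_of_lower_bound C (K : R) : is_bop ip C -> 0 <= K ->
  (forall n (x : nat -> H) (nu : R), 0 < nu ->
    (forall i j : 'I_n.+1, ip (x i) (x j) = (i == j)%:R) ->
    (forall i j : 'I_n.+1, i != j -> ip (C (x i)) (C (x j)) = 0) ->
    (forall i : 'I_n.+1, nu <= N (C (x i))) ->
    1 <= K / nu * s (DH ip D) (DH ip D) Phi n) ->
  I (cseq (sing ip C)).
Proof.
move=> bC K0 low.
have [[_ /(_ _ _ _ (DH_banach DP) (DH_banach DP) bPhi)[_ sge _]] _ _ _ _] := sP.
apply: (calkin_le IP (calkinZ IP (4 * K) (calkin_half IP IPhi))) => n.
  exact: sing_ge0.
apply: le_trans (sing_mono hP bC (_ : (n./2.*2 <= n)%N)) _.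
  by rewrite -{2}(odd_double_half n) leq_addl.
move: n./2 => k; have Ks0 : 0 <= 4 * K * s (DH ip D) (DH ip D) Phi k by rewrite !mulr_ge0.
have [sk0|sk0] := leP (sing ip C k.*2) 0; first exact: le_trans sk0 Ks0.
have [x [xo Co Cx]] := sing_ortho_vectors hP bC sk0.
have nu0 : 0 < sing ip C k.*2 / 4 by lra.
have := low k x _ nu0.
move=> /(_ _ _ _)/(ler_wpM2l (ltW nu0)); rewrite mulr1 mulrA mulrCA mulfV ?gt_eqF// mulr1.
move=> le_k; suff : sing ip C k.*2 / 4 <= K * s (DH ip D) (DH ip D) Phi k by lra.
apply: le_k => [i j|i j ij|i].
- by rewrite xo// -ltnS.
- by rewrite Co.
- by rewrite Cx// -ltnS.
Qed.

Section OrthogonalImages.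
Variables (C : H -> H) (n : nat) (x : nat -> H) (nu : R).
Hypotheses (bC : is_bop ip C) (nu0 : 0 < nu).
Hypothesis xo : forall i j : 'I_n.+1, ip (x i) (x j) = (i == j)%:R.
Hypothesis Co : forall i j : 'I_n.+1, i != j -> ip (C (x i)) (C (x j)) = 0.
Hypothesis Cnu : forall i : 'I_n.+1, nu <= N (C (x i)).

Let t (l : 'I_n.+1) := N (C (x l)).
Let y (l : 'I_n.+1) := ((t l)^-1%:C)%C *: C (x l).

Let t0 l : 0 < t l.
Proof. exact: lt_le_trans nu0 (Cnu l). Qed.

Let ip_Cxy (i j : 'I_n.+1) : ip (C (x i)) (y j) = ((t i)%:C)%C * (i == j)%:R.
Proof.
rewrite /y (ipZr ipP) conjc_real; have [<-|/Co ->] := eqVneq i j; last by rewrite !mulr0.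
by rewrite (ipxx ipP) -rmorphM /= expr2 mulKf ?(gt_eqF (t0 _))// mulr1.
Qed.

Let yo (i j : 'I_n.+1) : ip (y i) (y j) = (i == j)%:R.
Proof.
by rewrite {1}/y (ipZl ipP) ip_Cxy mulrA -rmorphM /= mulVf ?(gt_eqF (t0 _))// real_complex1 mul1r.
Qed.

(** T spreads the coordinates over the x_j in the first factor of a rank one operator. S reads the
    coordinates of Y w along the orthonormal y_l and divides by t_l; by Bessel its norm is at most
    |w| / nu. As C x_l = t_l y_l, the composite is the identity. *)
Lemma lower_bound_left u w : C = \sum_i ip (B i w) u *: A i ->
  1 <= N w * N u / nu * s (DH ip D) (DH ip D) Phi n.
Proof.
move=> CE.
pose comb (a : 'rV[R[i]]_n.+1) := \sum_(j < n.+1) a 0 j *: x j.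
pose T a := rank1 ip (comb a) u.
pose S (Y : H -> H) := \row_(l < n.+1) (ip (Y w) (y l) * ((t l)^-1%:C)%C).
have combN a : N (comb a) = hnorm (@rv_ip R n.+1) a.
  apply/eqP; rewrite -(eqrXn2 (n := 2)) ?hnorm_ge0//.
  by rewrite (parseval hP)// rv_hnorm_sqr.
rewrite (mulrAC (N w)).
apply: (@sfunction_ge _ _ _ D DP s Phi n T S (N u) (N w / nu) sP bPhi).
- exact: hnorm_ge0.
- by rewrite divr_ge0 ?hnorm_ge0// ltW.
- by move=> a; apply: (D_rank1 DP).
- move=> a b; apply/funext => v; rewrite /T /rank1 !fctE -scalerDr; congr (_ *: _).
  by rewrite /comb -big_split; apply: eq_bigr => j _; rewrite mxE scalerDl.
- move=> c a; apply/funext => v; rewrite /T /rank1 !fctE scalerA mulrC -scalerA.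
  congr (_ *: _); rewrite /comb scaler_sumr; apply: eq_bigr => j _.
  by rewrite mxE scalerA.
- move=> a; apply: (bop_opn_le hP) => [|v]; first by rewrite mulr_ge0 ?hnorm_ge0.
  by rewrite mulrC (mulrC (N u)) -combN mulrC; apply: rank1_le.
- by move=> X Y; apply/rowP => l; rewrite !mxE !fctE (ipDl ipP) mulrDl.
- by move=> c X; apply/rowP => l; rewrite !mxE !fctE (ipZl ipP) mulrA.
- move=> X DX; have bX := D_bop DP DX; rewrite mulrAC (mulrC (N w)).
  apply: rv_hnorm_row_le => //; first by rewrite mulr_ge0 ?hnorm_ge0 ?(bop_opn_ge0 hP).
  apply: le_trans (bessel hP _ yo) _.
  by rewrite ler_pXn2r ?nnegrE ?mulr_ge0 ?hnorm_ge0 ?(bop_opn_ge0 hP)//; apply: bopP.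
move=> a; apply/rowP => l; rewrite mxE PhiE; last exact: (D_rank1 DP).
have -> : \sum_i A i (T a (B i w)) = C (comb a).
  rewrite CE fct_sumE; apply: eq_bigr => i _.
  by rewrite /T /rank1 (bopZ (bA i)) !fctE.
rewrite /comb (bop_sum bC) (ip_suml ipP) (bigD1 l)//= big1 ?addr0 => [|j jl].
  rewrite (bopZ bC) (ipZl ipP) ip_Cxy eqxx mulr1 -mulrA -rmorphM /= mulfV ?(gt_eqF (t0 _))//.
  by rewrite real_complex1 mulr1.
by rewrite (bopZ bC) (ipZl ipP) ip_Cxy (negPf jl) !mulr0.
Qed.

Lemma lower_bound_right v z : C = \sum_i ip (A i v) z *: B i ->
  1 <= N z * N v / nu * s (DH ip D) (DH ip D) Phi n.
Proof.
move=> CE.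
pose comb (a : 'rV[R[i]]_n.+1) := \sum_(j < n.+1) conjc (a 0 j) *: y j.
pose T a := rank1 ip v (comb a).
pose S (Y : H -> H) := \row_(l < n.+1) (ip (Y (x l)) z * ((t l)^-1%:C)%C).
have combN a : N (comb a) = hnorm (@rv_ip R n.+1) a.
  apply/eqP; rewrite -(eqrXn2 (n := 2)) ?hnorm_ge0//.
  rewrite (parseval hP)// rv_hnorm_sqr; apply/eqP; apply: eq_bigr => j _.
  by rewrite cabsJ.
have ip_comb h a : ip h (comb a) = \sum_j a 0 j * ip h (y j).
  rewrite /comb (ip_sumr ipP); apply: eq_bigr => j _.
  by rewrite (ipZr ipP) conjcK.
rewrite (mulrAC (N z)).
apply: (@sfunction_ge _ _ _ D DP s Phi n T S (N v) (N z / nu) sP bPhi).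
- exact: hnorm_ge0.
- by rewrite divr_ge0 ?hnorm_ge0// ltW.
- by move=> a; apply: (D_rank1 DP).
- move=> a b; apply/funext => h; rewrite /T /rank1 !fctE -scalerDl; congr (_ *: _).
  by rewrite !ip_comb -big_split; apply: eq_bigr => j _; rewrite mxE mulrDl.
- move=> c a; apply/funext => h; rewrite /T /rank1 !fctE scalerA; congr (_ *: _).
  by rewrite !ip_comb mulr_sumr; apply: eq_bigr => j _; rewrite mxE mulrA.
- move=> a; apply: (bop_opn_le hP) => [|h]; first by rewrite mulr_ge0 ?hnorm_ge0.
  by rewrite -combN; apply: rank1_le.
- by move=> X Y; apply/rowP => l; rewrite !mxE !fctE (ipDl ipP) mulrDl.
- by move=> c X; apply/rowP => l; rewrite !mxE !fctE (ipZl ipP) mulrA.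
- move=> X DX; have bX := D_bop DP DX; rewrite mulrAC (mulrC (N z)).
  have X0 := bop_opn_ge0 hP bX.
  apply: rv_hnorm_row_le => //; first by rewrite mulr_ge0 ?hnorm_ge0.
  have [X' bX' XX'] := adjoint hP bX.
  have X'z : N (X' z) <= opn X * N z.
    apply: (hnorm_le_dual ipP); first by rewrite mulr_ge0 ?hnorm_ge0.
    move=> h; rewrite (ipC ipP h) cabsJ -XX'; apply: le_trans (cauchy_schwarz ipP _ _) _.
    by rewrite mulrAC ler_wpM2r ?hnorm_ge0//; apply: bopP.
  apply: (@le_trans _ _ (N (X' z) ^+ 2)); last first.
    by rewrite ler_pXn2r ?nnegrE ?mulr_ge0 ?hnorm_ge0.
  apply: le_trans (bessel hP (X' z) xo); apply: ler_sum => l _.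
  by rewrite XX' (ipC ipP (X' z)) cabsJ.
move=> a; apply/rowP => l; rewrite mxE PhiE; last exact: (D_rank1 DP).
have -> : ip (\sum_i A i (T a (B i (x l)))) z = ip (C (x l)) (comb a).
  rewrite CE fct_sumE !(ip_suml ipP); apply: eq_bigr => i _.
  by rewrite /T /rank1 (bopZ (bA i)) !fctE !(ipZl ipP) mulrC.
rewrite ip_comb (bigD1 l)//= big1 ?addr0 => [|j jl].
  by rewrite ip_Cxy eqxx mulr1 -mulrA -rmorphM /= mulfV ?(gt_eqF (t0 _))// real_complex1 mulr1.
by rewrite ip_Cxy eq_sym (negPf jl) !mulr0.
Qed.

End OrthogonalImages.

Lemma sing_class_left u w : I (cseq (sing ip (\sum_i ip (B i w) u *: A i))).
Proof.
have bC : is_bop ip (\sum_i ip (B i w) u *: A i).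
  by apply: (is_bop_sum hP) => i; apply: is_bopZ.
apply: (sing_class_of_lower_bound bC (mulr_ge0 (hnorm_ge0 ip w) (hnorm_ge0 ip u))).
by move=> n x nu nu0 xo Co Cnu; exact: (lower_bound_left bC nu0 xo Co Cnu erefl).
Qed.

Lemma sing_class_right v z : I (cseq (sing ip (\sum_i ip (A i v) z *: B i))).
Proof.
have bC : is_bop ip (\sum_i ip (A i v) z *: B i).
  by apply: (is_bop_sum hP) => i; apply: is_bopZ.
apply: (sing_class_of_lower_bound bC (mulr_ge0 (hnorm_ge0 ip z) (hnorm_ge0 ip v))).
by move=> n x nu nu0 xo Co Cnu; exact: (lower_bound_right nu0 xo Co Cnu erefl).
Qed.

End LowerBound.

(** * Minimal representations and conclusion *)

Section MinimalRepresentation.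
Variables (R : realType) (H : lmodType R[i]) (ip : H -> H -> R[i]).
Hypothesis hP : is_hilbert ip.
Local Notation hs := (hspace ip).
Let ipP := hilbert_inner hP.

Lemma sing_class_linear (I : set (nat -> R[i])) (a : R[i]) A B : is_calkin I ->
  is_bop ip A -> is_bop ip B -> I (cseq (sing ip A)) -> I (cseq (sing ip B)) ->
  I (cseq (sing ip (a *: A + B))).
Proof.
move=> IP bA bB /(approximable_singP IP hP bA) IA /(approximable_singP IP hP bB) IB.
have bh := hspace_banach hP; have bZ := is_bopZ hP a bA.
apply/(approximable_singP IP hP (is_bopD hP bZ bB)).
exact: (approximableD IP bh bZ bB (approximableZ IP bh bh a bA IA) IB).
Qed.

(** The coefficient vectors whose combination has singular numbers in I form a subspace. No nonzero
    d annihilates it, so it contains the unit vectors. *)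
Lemma sing_class_span (I : set (nat -> R[i])) m (A : 'I_m -> H -> H) (P : 'rV[R[i]]_m -> Prop) :
  is_calkin I -> (forall i, is_bop ip (A i)) ->
  (forall d : 'rV[R[i]]_m, d != 0 -> exists2 v : 'rV[R[i]]_m, P v & \sum_i d 0 i * v 0 i != 0) ->
  (forall v, P v -> I (cseq (sing ip (\sum_i v 0 i *: A i)))) ->
  forall i, I (cseq (sing ip (A i))).
Proof.
move=> IP bA Pd PV i.
have bcomb (v : 'rV[R[i]]_m) : is_bop ip (\sum_i v 0 i *: A i).
  by apply: (is_bop_sum hP) => j; apply: is_bopZ.
have [|a v w Vv Vw||[d d0 dV]] := subspace_full_or_annihilated
    (V := fun v : 'rV[R[i]]_m => I (cseq (sing ip (\sum_i v 0 i *: A i)))).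
- rewrite big1 => [|j _]; last by rewrite mxE scale0r.
  apply/(approximable_singP IP hP (is_bop0 hP)).
  exact: (approximable0 IP (hspace_banach hP) (hspace_banach hP)).
- have -> : \sum_i (a *: v + w) 0 i *: A i =
      a *: (\sum_i v 0 i *: A i) + \sum_i w 0 i *: A i.
    rewrite scaler_sumr -big_split; apply: eq_bigr => j _.
    by rewrite !mxE scalerDl scalerA.
  exact: sing_class_linear.
- move=> /(_ (delta_mx 0 i)); rewrite (bigD1 i)//= mxE !eqxx scale1r big1 ?addr0// => j ji.
  by rewrite mxE (negPf ji) andbF scale0r.
by have [v /PV/dV ->] := Pd d d0; rewrite eqxx.
Qed.

Variables (D : set (H -> H)).
Hypothesis DP : operator_space ip D.
Variable Phi : (H -> H) -> H -> H.

(** A linear relation is solved for an operator with nonzero coefficient, and its partner is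
    absorbed into the partners of the others. *)
Lemma elem_rep_drop m (A B : 'I_m.+1 -> H -> H) (d : 'rV[R[i]]_m.+1) : elem_rep ip D Phi A B ->
  d != 0 -> \sum_i d 0 i *: A i = 0 \/ \sum_i d 0 i *: B i = 0 ->
  exists A' B' : 'I_m -> H -> H, elem_rep ip D Phi A' B'.
Proof.
move=> [bAB PhiE] /rV0Pn[k dk].
have bA i := (bAB i).1; have bB i := (bAB i).2.
pose t i := d 0 (lift k i) / d 0 k.
have solve (C : 'I_m.+1 -> H -> H) : \sum_i d 0 i *: C i = 0 ->
    forall x, C k x = - \sum_i t i *: C (lift k i) x.
  rewrite (bigD1_ord k)//= => /(congr1 (fun f : H -> H => (d 0 k)^-1 *: f)) /=.
  rewrite scalerDr scalerA mulVf// scale1r scaler0 => /eqP.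
  rewrite addr_eq0 => /eqP -> x; rewrite !fctE fct_sumE scaler_sumr; congr (- _).
  by apply: eq_bigr => i _; rewrite !fctE scalerA mulrC.
case=> /solve CE.
  exists (fun i => A (lift k i)), (fun i => B (lift k i) - t i *: B k); split.
    by move=> j; split=> //; apply: (is_bopB hP) => //; apply: is_bopZ.
  move=> X DX; have bX := D_bop DP DX; rewrite PhiE// (bigD1_ord k)//=.
  apply/funext => x; rewrite !fctE !fct_sumE /Mop /= CE -sumrN -big_split /=.
  apply: eq_bigr => i _; rewrite !fctE (bopB bX) (bopB (bA _)) (bopZ bX) (bopZ (bA _)).
  by rewrite addrC.
exists (fun i => A (lift k i) - t i *: A k), (fun i => B (lift k i)); split.
  by move=> j; split=> //; apply: (is_bopB hP) => //; apply: is_bopZ.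
move=> X DX; have bX := D_bop DP DX; rewrite PhiE// (bigD1_ord k)//=.
apply/funext => x; rewrite !fctE !fct_sumE /Mop /= CE (bopN bX) (bopN (bA k)).
rewrite (bop_sum bX) (bop_sum (bA k)) -sumrN -big_split /=.
apply: eq_bigr => i _; rewrite !fctE (bopZ bX) (bopZ (bA _)).
by rewrite addrC.
Qed.

Lemma minimal_elem_rep : elementary_on ip D Phi ->
  exists m (A B : 'I_m -> H -> H), elem_rep ip D Phi A B /\
  forall d : 'rV[R[i]]_m, d != 0 -> \sum_i d 0 i *: A i != 0 /\ \sum_i d 0 i *: B i != 0.
Proof.
move=> el.
have exm : exists m, `[< exists A B : 'I_m -> H -> H, elem_rep ip D Phi A B >].
  by case: el => m AB; exists m; apply/asboolP.
have [m /asboolP[A [B rep]] minm] := ex_minnP exm.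
exists m, A, B; split=> // d d0; apply/andP; rewrite -negb_or; apply/negP => AB0.
case: m A B rep minm d d0 AB0 => [|m] A B rep minm d d0 AB0.
  by case/rV0Pn: d0 => -[].
have [|A' [B' rep']] := elem_rep_drop rep d0.
  by case/orP: AB0 => /eqP; [left|right].
by have := minm m (asboolT (ex_intro _ A' (ex_intro _ B' rep'))); rewrite ltnn.
Qed.

Lemma elementary_sing_class (I : set (nat -> R[i])) s :
  is_calkin I -> stable I -> is_sfunction s -> elementary_on ip D Phi ->
  I (cseq (s (DH ip D) (DH ip D) Phi)) <->
  exists m (A B : 'I_m -> (H -> H)), elem_rep ip D Phi A B /\
    (forall j, I (cseq (sing ip (A j))) /\ I (cseq (sing ip (B j)))).
Proof.
move=> IP sI sP el; split=> [IPhi|[m [A [B [rep IAB]]]]]; last first.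
  have bD := DH_banach DP; have bAB := rep.1.
  apply: (approximable_sfunction IP bD bD sP (elem_rep_bounded hP DP rep)).
  apply: (@approximable_ext R I (DH ip D) (DH ip D)
    (fun X => \sum_(j < m) Mop (A j) (B j) X)) => [X DX|]; first by rewrite rep.2.
  apply: (approximable_sum IP bD bD) => j.
    by have [bA bB] := bAB j; apply: Mop_bounded.
  by have [[bA bB] [IA IB]] := (bAB j, IAB j); apply: Mop_approximable.
have [m [A [B [rep indep]]]] := minimal_elem_rep el.
exists m, A, B; split=> //.
have bA i : is_bop ip (A i) := (rep.1 i).1; have bB i : is_bop ip (B i) := (rep.1 i).2.
(* If d annihilated all vectors (<C_i w, u>)_i, all matrix coefficients of the sum of the d_i C_i
   would vanish. *)
have sep (C : 'I_m -> H -> H) (d : 'rV[R[i]]_m) : \sum_i d 0 i *: C i != 0 ->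
    exists2 v : 'rV[R[i]]_m, (exists w u, v = \row_i ip (C i w) u) &
      \sum_i d 0 i * v 0 i != 0.
  move=> dC; apply: contrapT => nv; case/negP: dC; apply/eqP/funext => w.
  apply: (ip_inj ipP) => u; rewrite fct_sumE (ip_suml ipP) (ip0l ipP).
  apply: contrapT => /eqP wu; apply: nv.
  exists (\row_i ip (C i w) u); first by exists w, u.
  apply: contraNneq wu => {2}<-; apply/eqP; apply: eq_bigr => i _.
  by rewrite mxE !fctE (ipZl ipP).
move=> j; split.
  apply: (sing_class_span IP bA (P := fun v => exists w u, v = \row_i ip (B i w) u)).
    by move=> d /indep[_ dB]; apply: sep.
  move=> _ [w [u ->]]; under eq_bigr do rewrite mxE.
  exact: (sing_class_left hP DP IP sP rep IPhi).
apply: (sing_class_span IP bB (P := fun v => exists w u, v = \row_i ip (A i w) u)).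
  by move=> d /indep[dA _]; apply: sep.
move=> _ [w [u ->]]; under eq_bigr do rewrite mxE.
exact: (sing_class_right hP DP IP sP rep IPhi).
Qed.

End MinimalRepresentation.

Theorem theorem4p6 (R : realType) (H : lmodType R[i]) (ip : H -> H -> R[i])
    (I : set (nat -> R[i]))
    (s : forall X Y : nspace R, (nsV X -> nsV Y) -> nat -> R) :
  is_hilbert ip -> separable ip ->
  is_calkin I -> stable I ->
  is_sfunction s ->
  (* elementary operators on B(H) *)
  (forall Phi : (H -> H) -> (H -> H),
     elementary_on ip (is_bop ip) Phi ->
     (I (cseq (s (BH ip) (BH ip) Phi)) <->
      exists m (A B : 'I_m -> (H -> H)),
        elem_rep ip (is_bop ip) Phi A B /\
        (forall j, I (cseq (sing ip (A j))) /\ I (cseq (sing ip (B j)))))) /\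
  (* elementary operators on K(H) *)
  (forall Phi : (H -> H) -> (H -> H),
     elementary_on ip (is_compact_op ip) Phi ->
     (I (cseq (s (KH ip) (KH ip) Phi)) <->
      exists m (A B : 'I_m -> (H -> H)),
        elem_rep ip (is_compact_op ip) Phi A B /\
        (forall j, I (cseq (sing ip (A j))) /\ I (cseq (sing ip (B j)))))).
Proof.
move=> hP _ IP sI sP; split=> Phi el.
  (* [BH ip] and [KH ip] are instances of [DH ip] up to conversion. *)
  exact: (elementary_sing_class hP (bounded_operators_space hP) IP sI sP el).
exact: (elementary_sing_class hP (compact_operators_space hP) IP sI sP el).
Qed.
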